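(* Let $(S_t)_{t\ge0}$ be the semigroup of the asymmetric exclusion process on $\Omega=\{0,1\}^{\mathbb{Z}^d}$ and let $\nu_\rho$ be the Bernoulli product measure with density $\rho$, i.e. $\nu_\rho(\eta_x=1)=\rho$. Define, for $k\in\mathbb{Z}^d$, $$\Psi_t(k)=\left(\int\Big(\mathbb{P}_{\eta_{\neq0}1_0,\,\eta_{\neq0}0_0}(X_t=k)\Big)^2d\nu_\rho(\eta)\right)^{1/2},$$ where $X_t$ is the position of the second class particle started at the origin. Then, for all bounded measurable $f:\Omega\to\mathbb{R}$ and all $t\geq0$, $$\mathrm{Var}_{\nu_\rho}(S_tf)\leq\|\Psi_t\|_2^2\,\|\delta f\|_1^2.$$
   Context: $\Omega=\{0,1\}^{\mathbb{Z}^d}$ with product topology and Borel $\sigma$-field. $\eta^{xy}$ is $\eta$ with the values at $x$ and $y$ exchanged; $\eta^i$ is $\eta$ flipped at $i$. The asymmetric exclusion process has generator, on functions depending on finitely many sites, $Lf(\eta)=\sum_{x,y}p(x,y)\,\eta(x)(1-\eta(y))\,(f(\eta^{xy})-f(\eta))$, where $p(x,y)=p(0,y-x)$ is a translation-invariant nearest-neighbour random walk kernel on $\mathbb{Z}^d$ with non-zero mean. $S_tf(\eta)=\mathbb{E}_\eta f(\eta_t)$. $\eta_{\neq0}a_0$ is the configuration equal to $\eta$ off the origin and to $a$ at the origin. $\mathbb{P}_{\eta_{\neq0}1_0,\eta_{\neq0}0_0}$ is the basic coupling of two copies of the process started from these two configurations (both copies use the same jump attempts, i.e. for each ordered pair $(x,y)$,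 at rate $p(x,y)$, in each copy a particle at $x$, if any, jumps to $y$ if $y$ is empty). Under this coupling, at each time $t$ there is exactly one site at which the two copies differ; this site is $X_t$ (the second class particle). $\delta_if=\sup_\eta(f(\eta^i)-f(\eta))$, $\|\delta f\|_1=\sum_i\delta_if$ (the bound is vacuous if this is infinite); $\|\Psi_t\|_2$ is the $\ell^2(\mathbb{Z}^d)$ norm. *)

(* Defs.v *)
From HB Require Import structures.
From mathcomp Require Import all_boot all_order all_algebra finmap.
From mathcomp Require Import all_classical all_reals all_analysis.

Set Implicit Arguments.
Unset Strict Implicit.
Unset Printing Implicit Defensive.

Import Order.TTheory GRing.Theory Num.Theory.
Import numFieldNormedType.Exports.

Local Open Scope classical_set_scope.
Local Open Scope ring_scope.

Notation site d := 'rV[int]_d (only parsing).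

(** The configuration space carries the product topology of the discrete
    topologies, and its Borel sigma-algebra. *)
Definition conf (d : nat) := prod_topology (fun _ : site d => bool).

HB.instance Definition _ d := Topological.on (conf d).
HB.instance Definition _ d := Pointed.copy (conf d) (site d -> bool).
HB.instance Definition _ d :=
  Measurable.copy (conf d) (g_sigma_algebraType (@open (conf d))).

Section Configurations.
Variable d : nat.
Implicit Types (eta : conf d) (x y i : site d).

Definition exchange x y eta : conf d :=
  fun z => if z == x then eta y else if z == y then eta x else eta z.

Definition flip i eta : conf d :=
  fun z => if z == i then ~~ eta z else eta z.

Definition set_origin eta (a : bool) : conf d :=
  fun z => if z == 0 then a else eta z.

End Configurations.

Section Semigroup.
Context (dX : measure_display) (X : measurableType dX) (R : realType).
Implicit Types (P : R -> R.-pker X ~> X) (f g : X -> R).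

(** [S_t f (x) = E_x (f (eta_t))], where [P t x] is the law of [eta_t] for the
    process started from [x]. Only [P t] with [0 <= t] is meaningful. *)
Definition semigroup P (t : R) f : X -> R :=
  fun x => \int[P t x]_y f y.

(** [C] is the space of continuous real functions on [X] (it is a parameter
    because [X] comes here without a topology). *)
Definition Feller (C : set (X -> R)) P : Prop :=
  [/\ forall x A, measurable A -> P 0 x A = \d_x A,
      forall (s t : R) x A, 0 <= s -> 0 <= t -> measurable A ->
        P (s + t) x A = (\int[P s x]_y P t y A)%E,
      forall (t : R) f, 0 <= t -> C f -> C (semigroup P t f)
    & forall f, C f -> {uniform, semigroup P h f @[h --> 0^'+] --> f}].

(** [f] is in the domain of the generator of [P], with image [g]. *)
Definition generates P f g : Prop :=
  {uniform, (fun x => h^-1 * (semigroup P h f x - f x)) @[h --> 0^'+] --> g}.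

End Semigroup.

Section Exclusion.
Context (d : nat) (R : realType).
Implicit Types (p : site d -> site d -> R) (eta : conf d).

Definition nn_kernel p : Prop :=
  [/\ forall x y, 0 <= p x y,
      forall x, \sum_(y \in [set: site d]) p x y = 1,
      forall x y, p x y = p 0 (y - x)
    & forall x y, p x y != 0 -> \sum_(j < d) `|(y - x) 0 j| = 1].

Definition mean p : 'rV[R]_d :=
  \sum_(z \in [set: site d]) p 0 z *: map_mx intr z.

Definition cylinder (f : conf d -> R) : Prop :=
  exists2 A : set (site d), finite_set A &
    forall eta xi, (forall x, A x -> eta x = xi x) -> f eta = f xi.

Definition cylinder2 (F : conf d * conf d -> R) : Prop :=
  exists2 A : set (site d), finite_set A &
    forall z w, (forall x, A x -> z.1 x = w.1 x /\ z.2 x = w.2 x) -> F z = F w.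

(** The two generators below are only used on functions of finitely many sites
    and for nearest-neighbour [p]: then only finitely many pairs [xy] contribute
    to the sum, which is what the finite-support sum requires. *)
Definition exclusion_gen p (f : conf d -> R) : conf d -> R := fun eta =>
  \sum_(xy \in [set: site d * site d])
    p xy.1 xy.2 * (eta xy.1)%:R * (1 - (eta xy.2)%:R)
    * (f (exchange xy.1 xy.2 eta) - f eta).

(** Effect on [eta] of an attempted jump from [x] to [y]. *)
Definition attempt (x y : site d) eta : conf d :=
  if eta x && ~~ eta y then exchange x y eta else eta.

Definition coupling_gen p (F : conf d * conf d -> R) : conf d * conf d -> R :=
  fun z => \sum_(xy \in [set: site d * site d])
    p xy.1 xy.2 * (F (attempt xy.1 xy.2 z.1, attempt xy.1 xy.2 z.2) - F z).

Definition exclusion_process p (P : R -> R.-pker (conf d) ~> (conf d)) : Prop :=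
  Feller [set f : conf d -> R | continuous f] P /\
  forall f, cylinder f -> generates P f (exclusion_gen p f).

Definition basic_coupling p
    (Q : R -> R.-pker (conf d * conf d) ~> (conf d * conf d)%type) : Prop :=
  Feller [set F : conf d * conf d -> R | continuous F] Q /\
  forall F, cylinder2 F -> generates Q F (coupling_gen p F).

(** Pairs of configurations whose unique discrepancy is at [k]; under the
    coupling started from a single discrepancy this is the event [X_t = k]. *)
Definition second_class_at (k : site d) : set (conf d * conf d) :=
  [set z | forall x, z.1 x != z.2 x <-> x = k].

Definition Psi (nu : probability (conf d) R)
    (Q : R -> R.-pker (conf d * conf d) ~> (conf d * conf d)%type)
    (t : R) (k : site d) : R :=
  Num.sqrt (\int[nu]_eta
    (fine (Q t (set_origin eta true, set_origin eta false)
             (second_class_at k))) ^+ 2).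

Definition bernoulli_product (rho : R) (nu : probability (conf d) R) : Prop :=
  forall (A : {fset site d}) (a : site d -> bool),
    nu [set eta | forall x, x \in A -> eta x = a x] =
    (\prod_(x <- A) (if a x then rho else 1 - rho))%:E.

Definition delta (f : conf d -> R) (i : site d) : R :=
  sup [set f (flip i eta) - f eta | eta in [set: conf d]].

Definition l1norm (u : site d -> R) : \bar R :=
  (\esum_(i in [set: site d]) `|u i|%:E)%E.

Definition l2norm (u : site d -> R) : \bar R :=
  ((\esum_(i in [set: site d]) (`|u i| ^+ 2)%:E) `^ 2^-1)%E.

End Exclusion.

(* Main.v *)
Require Import Defs.
From HB Require Import structures.
From mathcomp Require Import all_boot all_order all_algebra finmap.
From mathcomp Require Import all_classical all_reals all_analysis.
From mathcomp Require Import measurable_realfun ring lra.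

Set Implicit Arguments.
Unset Strict Implicit.
Unset Printing Implicit Defensive.

Import Order.TTheory GRing.Theory Num.Theory.
Import numFieldNormedType.Exports.

Local Open Scope classical_set_scope.
Local Open Scope ring_scope.

(** Put [g = S_t f]. The Efron-Stein inequality bounds [Var g] by the sum over [i]
    of the mean squares of [g(eta_i1) - g(eta_i0)]. Start the basic coupling from
    the two configurations that differ at [i] only: its marginals are the
    exclusion process, and at time [t] the two copies differ at exactly one site,
    so [|g(eta_i1) - g(eta_i0)| <= sum_k delta_k f * P_i,eta(X_t = k)]. By
    Cauchy-Schwarz with the weights [delta_k f], the square is at most
    [||delta f||_1 * sum_k delta_k f * P_i,eta(X_t = k)^2]. By translation
    invariance the integral of [P_i,eta(X_t = k)^2] is [Psi_t(k - i)^2], and summing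
    over [i] gives the claim.

    The processes are only known through their generators on cylinder functions.
    For [f] depending on [m] sites, [L f] is a combination of functions of at most
    [m + 1] sites with total weight [2 m], so iterating [L] [n] times costs a factor
    of order [(m + n)! / m!] and the Taylor series of [S_t f] converges for small
    [t], uniformly in [f]. Hence quantities that satisfy the same linear evolution
    equation and vanish at time [0] vanish for all times. This yields the
    marginals and the translation covariance of the coupling, and the fact that
    it never has more than one discrepancy. The discrepancy is not lost at infinity,
    since a function decreasing slowly with the distance to its starting point has a
    small time derivative. *)

(** * Hierarchies of differential inequalities *)

(** Uniqueness for Markov semigroups is usually obtained by differentiating [S_(t-s) T_s f] in [s],
    which requires the generator on [T_s f]. Here the generator is given on functions of finitely
    many sites only, and [T_s f] is in general not of this kind. The Taylor argument never leaves
    that class. It works for all times because its radius of convergence is the same for all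
    functions: the support size [m] enters through a binomial coefficient at most [2^(m + n)], hence
    only as a factor [2^m], and time advances by steps of constant length.

    Two more obstacles shape the proof. The position of the second class particle is not a function
    of finitely many sites, so the generator is applied to one-site and two-site discrepancy events,
    and the position is recovered up to null sets. And [f] is merely measurable, so [S_t f] may
    depend on all sites without being continuous: Efron-Stein is proved for finite sets of sites up
    to an error [e], by exchanging the sites of two independent copies one after another. *)

Lemma le_power_of_derive (R : realType) (phi dphi : R -> R) (a b M : R) (n : nat) :
  a <= b -> {within `[a, b], continuous phi} ->
  (forall x, x \in `]a, b[ -> is_derive x 1 phi (dphi x)) ->
  (forall x, x \in `]a, b[ -> dphi x <= M * n.+1%:R * (x - a) ^+ n) ->
  phi b - phi a <= M * (b - a) ^+ n.+1.
Proof.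
move=> ab cphi dphiE dphile; rewrite -subr_ge0.
move: ab; rewrite le_eqVlt => /predU1P[<-|ab].
  by rewrite !subrr exprS mul0r mulr0 subr0.
(* The comparison function: [q - phi] has a nonnegative derivative, so the mean value theorem alone
   integrates the power bound. *)
pose q : R -> R := (M *: ((@id R - cst a) ^+ n.+1))%R.
have dq (x : R) : is_derive x 1 q (M * n.+1%:R * (x - a) ^+ n).
  by apply: is_derive_eq; rewrite !fctE subr0 /GRing.scale /= !mulr1 mulrA.
have dg x : x \in `]a, b[ ->
    is_derive x 1 (q - phi) (M * n.+1%:R * (x - a) ^+ n - dphi x).
  by move=> /dphiE dx; exact: is_deriveB.
have cg : {within `[a, b], continuous (q - phi)}.
  move=> x; apply: cvgB; last exact: cphi.
  have : {within `[a, b], continuous q}; last exact.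
  apply: continuous_subspaceT => y.
  by apply: differentiable_continuous; apply/derivable1_diffP;
    exact: (@ex_derive _ _ _ _ _ _ _ (dq y)).
have [c cab] := MVT ab dg cg.
have -> : (q - phi) b - (q - phi) a = M * (b - a) ^+ n.+1 - (phi b - phi a).
  by rewrite /q /= !fctE /= /GRing.scale/= subrr
    [0 ^+ _]exprS mul0r mulr0 sub0r opprK opprB addrA addrAC.
by move=> ->; rewrite mulr_ge0 ?subr_ge0 ?dphile// ltW.
Qed.

Section hierarchy.
(** [Cl m B f] stands for: [f] depends on at most [m] sites and is bounded by [B]. The factor 2 in
    [Phi_bound] leaves room for a difference of two evolutions. *)
Variables (R : realType) (F : Type) (I : eqType) (Cl : nat -> R -> F -> Prop).
Variable Phi : R -> F -> R.
Hypothesis Cl_ge0 : forall m B f, Cl m B f -> 0 <= B.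
Hypothesis Phi_bound : forall m B f (t : R), Cl m B f -> 0 <= t -> `|Phi t f| <= 2 * B.
Hypothesis Phi_cont : forall m B f T, Cl m B f ->
  {within `[0, T], continuous (Phi ^~ f)}.
Hypothesis Phi_derive : forall m B f, Cl m B f ->
  exists (s : seq I) (w : I -> R) (g : I -> F),
  [/\ forall i, i \in s -> 0 <= w i,
      \sum_(i <- s) w i <= 2 * m%:R,
      forall i, i \in s -> Cl m.+1 (2 * B) (g i) &
      forall t : R, 0 < t -> is_derive t 1 (Phi ^~ f) (\sum_(i <- s) w i * Phi t (g i))].

(* The binomial coefficient is the rising product [(m + 1) ... (m + n)] of the
   support sizes, divided by the [n!] of the iterated time integral. *)
Let taylor_bound (a : R) : 0 <= a -> (forall m B f, Cl m B f -> Phi a f = 0) ->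
  forall n m B f (t : R), Cl m B f -> a <= t ->
  `|Phi t f| <= 2 * B * 'C(m + n, n)%:R * 4 ^+ n * (t - a) ^+ n.
Proof.
move=> a0 Phia0; elim=> [|n ih] m B f t fC at_.
  rewrite bin0 !expr0 !mulr1; apply: Phi_bound fC _.
  exact: le_trans at_.
have [s [w [g [w0 sw gC dPhi]]]] := Phi_derive fC.
set M := 2 * B * _ * _.
have cPhi : {within `[a, t], continuous (Phi ^~ f)}.
  apply: continuous_subspaceW (Phi_cont (T := t) fC).
  by apply: subset_itvr; rewrite bnd_simp.
have bnd x : x \in `]a, t[ ->
    `|\sum_(i <- s) w i * Phi x (g i)| <= M * n.+1%:R * (x - a) ^+ n.
  rewrite in_itv/= => /andP[ax xt]; apply: (le_trans (ler_norm_sum _ _ _)).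
  (* The weight [2 m] is enlarged to [2 (m + 1)] so that the identity [(n + 1) C(m + n + 1, n + 1) =
     (m + 1) C(m + n + 1, n)] applies exactly. The 4 gained at each order is this 2 times the
     doubling of [B]. *)
  have -> : M * n.+1%:R * (x - a) ^+ n = (2 * m.+1%:R) *
      (2 * (2 * B) * 'C(m.+1 + n, n)%:R * 4 ^+ n * (x - a) ^+ n).
    have -> : M = 2 * B * 'C(m + n.+1, n.+1)%:R * 4 ^+ n.+1 by [].
    have : 'C(m + n.+1, n.+1)%:R * n.+1%:R = 'C(m.+1 + n, n)%:R * m.+1%:R :> R.
      rewrite -!natrM [in LHS]mulnC mul_bin_left addnS subSn ?leq_addl//.
      by rewrite addnK addSn mulnC.
    move=> e; rewrite -[_ * (x - a) ^+ n]mulrA exprS; have -> : forall u v y z : R,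
      2 * B * u * (4 * y) * (v * z) = 4 * 2 * B * (u * v) * y * z by move=> *; ring.
    by rewrite e; ring.
  apply: (@le_trans _ _ (\sum_(i <- s) w i *
      (2 * (2 * B) * 'C(m.+1 + n, n)%:R * 4 ^+ n * (x - a) ^+ n))).
    rewrite big_seq [leRHS]big_seq; apply: ler_sum => i si.
    rewrite normrM ger0_norm ?w0//; apply: ler_wpM2l; first exact: w0.
    by apply: ih; [exact: gC|exact: ltW].
  rewrite -mulr_suml; apply: ler_wpM2r.
    have B0 := Cl_ge0 fC.
    by rewrite !mulr_ge0// ?exprn_ge0 ?subr_ge0// ltW.
  by apply: (le_trans sw); rewrite ler_pM2l// ler_nat.
rewrite ler_norml; apply/andP; split; last first.
  rewrite -[leLHS]subr0 -(Phia0 _ _ _ fC).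
  apply: (le_power_of_derive at_ cPhi) => x xat.
    by apply: dPhi; rewrite (le_lt_trans a0)//; move: xat; rewrite in_itv => /andP[].
  exact: le_trans (ler_norm _) (bnd _ xat).
rewrite lerNl -[leLHS]subr0 -oppr0 -(Phia0 _ _ _ fC).
apply: (@le_power_of_derive _ (fun t => - Phi t f)
  (fun t => - \sum_(i <- s) w i * Phi t (g i))) => //.
- by move=> x; apply: cvgN; exact: cPhi.
- move=> x xat; apply: is_deriveN; apply: dPhi.
  by rewrite (le_lt_trans a0)//; move: xat; rewrite in_itv => /andP[].
- by move=> x xat; apply: le_trans (bnd _ xat); rewrite -normrN ler_norm.
Qed.

(** Since [C(m + n, n) <= 2^(m + n)], the Taylor bound is at most [2 B 2^m (8 (t - a))^n], which
    tends to 0 for [t - a <= 1/16]. This length depends on neither [m] nor [B], so the argument can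
    restart at [a + 1/16]. *)
Let hierarchy_step (a : R) : 0 <= a -> (forall m B f, Cl m B f -> Phi a f = 0) ->
  forall m B f (t : R), Cl m B f -> a <= t <= a + 16^-1 -> Phi t f = 0.
Proof.
move=> a0 Phia0 m B f t fC /andP[at_ ta].
have B0 := Cl_ge0 fC.
apply/eqP; rewrite -normr_le0; apply/ler_addgt0Pl => e e0; rewrite addr0.
have bn n : `|Phi t f| <= 2 * B * 2 ^+ m * 2^-1 ^+ n.
  apply: le_trans (taylor_bound a0 Phia0 n fC at_) _.
  rewrite -!mulrA; apply: ler_wpM2l => //; apply: ler_wpM2l => //.
  have -> : 2^-1 ^+ n = 2 ^+ n * (4 ^+ n * (16^-1) ^+ n) :> R.
    by rewrite -!exprMn; congr (_ ^+ _); lra.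
  rewrite [leRHS]mulrA -exprD; apply: ler_pM => //.
  - by rewrite mulr_ge0// exprn_ge0 // subr_ge0.
  - rewrite -natrX ler_nat; elim: (m + n)%N {2}n => [|k ihk] [|j];
      rewrite ?bin0 ?bin0n ?expn_gt0//.
    by rewrite binS expnS mul2n -addnn leq_add// ihk.
  - by rewrite ler_pM2l ?exprn_gt0//; apply: lerXn2r; rewrite ?nnegrE ?subr_ge0//; lra.
have : (fun n => 2 * B * 2 ^+ m * (2^-1 : R) ^+ n) @ \oo --> 2 * B * 2 ^+ m * 0.
  apply: cvgM; first exact: cvg_cst.
  by apply: cvg_expr; rewrite ger0_norm// invf_lt1// ltr1n.
rewrite mulr0 => /cvgrPdist_lt /(_ e e0)[N _ /(_ N (leqnn N))].
rewrite sub0r normrN => hN; apply: ltW; apply: le_lt_trans (bn N) _.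
exact: le_lt_trans (ler_norm _) hN.
Qed.

Lemma hierarchy_eq0 : (forall m B f, Cl m B f -> Phi 0 f = 0) ->
  forall m B f (t : R), Cl m B f -> 0 <= t -> Phi t f = 0.
Proof.
move=> Phi0.
have Phik k : forall m B f (t : R), Cl m B f -> 0 <= t <= 16^-1 * k%:R -> Phi t f = 0.
  elim: k => [|k ih] m B f t fC.
    by rewrite mulr0 -eq_le => /eqP <-; exact: Phi0 fC.
  have -> : 16^-1 * k.+1%:R = 16^-1 * k%:R + 16^-1 :> R by rewrite -natr1; ring.
  move=> /andP[t0 tk].
  have [tk'|tk'] := leP t (16^-1 * k%:R); first by apply: ih fC _; rewrite t0.
  apply: (@hierarchy_step (16^-1 * k%:R)) fC _; rewrite ?mulr_ge0//.
    by move=> ? ? ? gC; apply: ih gC _; rewrite mulr_ge0//=.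
  by rewrite (ltW tk') tk.
move=> m B f t fC t0; apply: (Phik (Num.trunc (16 * t)).+1) fC _; rewrite t0/=.
by rewrite mulrC ler_pdivlMr// mulrC ltW// truncnS_gt.
Qed.
End hierarchy.

(** * The Borel sets of the configuration space *)

Section conf_measurable.
Variable d : nat.
Implicit Types (A B : {fset site d}) (U : set (conf d)) (eta : conf d).

(** These events form a pi-system that generates the Borel sets; empty sites are reached by
    complements. Finite measures are compared on them. *)
Definition ones A : set (conf d) := [set eta | forall x, x \in A -> eta x].

Lemma ones_setI A B : ones A `&` ones B = ones (A `|` B)%fset.
Proof.
apply/seteqP; split=> [eta [hA hB] x|eta h].
  by rewrite inE => /orP[/hA|/hB].
by split=> x xA; apply: h; rewrite inE xA ?orbT.
Qed.

(** The filter [F] generated by the cylinders around [eta] fixes each coordinate eventually, hence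
    converges to [eta] in the product topology; so it contains every neighbourhood. *)
Lemma nbhs_conf eta U : nbhs eta U ->
  exists A, forall xi : conf d, (forall x, x \in A -> xi x = eta x) -> U xi.
Proof.
pose F : set_system (site d -> bool) := [set V | exists A : {fset site d},
  forall xi : conf d, (forall x, x \in A -> xi x = eta x) -> V xi].
have FF : Filter F.
  split.
  - by exists fset0.
  - move=> V W [A hA] [B hB]; exists (A `|` B)%fset => xi h.
    by split; [apply: hA|apply: hB] => x xA; apply: h; rewrite inE xA ?orbT.
  - by move=> V W VW [A hA]; exists A => xi /hA /VW.
suff : F --> (eta : sup_topology (fun i => Topological.class
    (initial_topology (fun f : site d -> bool => f i)))).
  by move=> h Ueta; exact: h Ueta.
apply/cvg_sup => i; apply/cvg_image.
  by apply/seteqP; split=> // b _; exists (fun=> b).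
move=> V /= Vi; exists ([set xi | V (xi i)]).
  by exists [fset i]%fset => xi h /=; rewrite h ?inE//; exact: nbhs_singleton.
by apply/seteqP; split=> [b [xi /= Vxi <-]//|b Vb]; exists (fun=> b).
Qed.

Lemma measurable_site x b : measurable [set eta : conf d | eta x = b].
Proof.
apply: sub_sigma_algebra.
rewrite (_ : [set _ | _] = (@proj _ (fun _ : site d => bool) x) @^-1` [set b])//.
by apply: open_comp; [move=> ? _; exact: proj_continuous | exact: discrete_open].
Qed.

(** An open set is the union of the cylinders inside it, and there are only countably many cylinders
    because pairs of finite sets of sites are countable. *)
Lemma measurable_confE : @measurable _ (conf d) = <<s range ones >>.
Proof.
have mones b x : <<s range ones >> [set eta : conf d | eta x = b].
  have m1 : <<s range ones >> [set eta : conf d | eta x = true].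
    apply: sub_sigma_algebra; exists [fset x]%fset => //.
    apply/seteqP; split=> eta /= h; first by apply: h; rewrite inE.
    by move=> y; rewrite inE => /eqP ->.
  case: b => //; have [_ hD _] := smallest_sigma_algebra setT (range ones).
  rewrite (_ : [set _ | _] = setT `\` [set eta : conf d | eta x = true]); first exact: hD.
  by apply/seteqP; split=> eta /=; [move=> ->; split | case=> _; case: (eta x)].
apply/seteqP; split; last first.
  apply: smallest_sub; first exact: sigma_algebra_measurable.
  move=> _ [A _ <-].
  rewrite (_ : ones A = \bigcap_(x in [set` A]) [set eta : conf d | eta x = true]).
    by apply: fin_bigcap_measurable => // x _; exact: measurable_site.
  by apply/seteqP; split=> eta h x; exact: h.
apply: smallest_sub; first exact: smallest_sigma_algebra.
move=> U Uo.
pose cyl (AB : {fset site d} * {fset site d}) : set (conf d) :=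
  [set eta | forall x, x \in AB.1 -> eta x = (x \in AB.2)].
have -> : U = \bigcup_(AB in [set AB | cyl AB `<=` U]) cyl AB.
  apply/seteqP; split=> [eta Ueta|eta [AB +]]; last exact.
  have [|A hA] := @nbhs_conf eta U; first exact: open_nbhs_nbhs.
  exists (A, [fset x in A | eta x]%fset) => /=.
    by move=> xi /= h; apply: hA => x xA; rewrite h// !inE xA.
  by move=> x /= xA; rewrite !inE xA.
rewrite bigcup_mkcond.
apply: (@countable_bigcupT_measurable _ (g_sigma_algebraType (range ones))) => //.
move=> [A B]; case: ifP => // _.
have -> : cyl (A, B) = \bigcap_(x in [set` A]) [set eta : conf d | eta x = (x \in B)].
  by apply/seteqP; split=> eta h x; exact: h.
apply: (@fin_bigcap_measurable _ (g_sigma_algebraType (range ones))) => // x _.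
exact: mones.
Qed.

Lemma measurable_ones A : measurable (ones A).
Proof. by rewrite measurable_confE; apply: sub_sigma_algebra; exists A. Qed.

Lemma measurable_fun_conf dT (T : measurableType dT) (h : T -> conf d) :
  (forall x, measurable [set u | h u x]) -> measurable_fun setT h.
Proof.
move=> mh; apply: (measurability _ measurable_confE) => _ [_ [A _ <-] <-].
rewrite setTI (_ : _ @^-1` _ = \bigcap_(x in [set` A]) [set u | h u x]).
  by apply: fin_bigcap_measurable => // x _; exact: mh.
by apply/seteqP; split=> u hu x; exact: hu.
Qed.

Lemma measure_conf_unique (R : realType) (m1 m2 : {measure set (conf d) -> \bar R}) :
  (m1 setT < +oo)%E -> (forall A, m1 (ones A) = m2 (ones A)) ->
  forall U, measurable U -> m1 U = m2 U.
Proof.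
move=> m1oo m12 U mU; apply: (measure_unique (range ones) (fun=> setT)) => //.
- exact: measurable_confE.
- by move=> _ _ [A _ <-] [B _ <-]; exists (A `|` B)%fset => //; rewrite ones_setI.
- by move=> _; exists fset0 => //; apply/seteqP; split.
- by apply/seteqP; split=> // eta _; exists 0%N.
- by move=> _ [A _ <-]; exact: m12.
Qed.

End conf_measurable.

(** * Semigroups acting on bounded measurable functions *)

Section bounded_measurable.
Context (dX : measure_display) (X : measurableType dX) (R : realType).
Implicit Types (f g : X -> R).

Definition bounded_measurable (B : R) f :=
  measurable_fun setT f /\ forall x, `|f x| <= B.

Lemma bounded_measurable_ge0 B f : bounded_measurable B f -> 0 <= B.
Proof. by move=> [_ /(_ point)]; exact: le_trans. Qed.

Lemma bounded_measurableB B C f g : bounded_measurable B f ->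
  bounded_measurable C g -> bounded_measurable (B + C) (f \- g).
Proof.
move=> [mf fB] [mg gC]; split; first exact: measurable_funB.
by move=> x /=; apply: (le_trans (ler_normB _ _)); exact: lerD.
Qed.

Lemma bounded_measurableZ B f r : bounded_measurable B f ->
  bounded_measurable (`|r| * B) (fun x => r * f x).
Proof.
move=> [mf fB]; split; first exact: measurable_funM.
by move=> x /=; rewrite normrM ler_wpM2l.
Qed.

Lemma bounded_measurable_sum B (I : Type) (s : seq I) (w : I -> R) (g : I -> X -> R) :
  (forall i, bounded_measurable B (g i)) ->
  bounded_measurable ((\sum_(i <- s) `|w i|) * B) (fun x => \sum_(i <- s) w i * g i x).
Proof.
move=> bg; split.
  by apply: measurable_sum => i; apply: measurable_funM => //; exact: (bg i).1.
move=> x; apply: (le_trans (ler_norm_sum _ _ _)); rewrite mulr_suml.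
by apply: ler_sum => i _; rewrite normrM ler_wpM2l//; exact: (bg i).2.
Qed.

Variable mu : {measure set X -> \bar R}.
Hypothesis mu1 : mu setT = 1%E.

Lemma bounded_measurable_integrable B f : bounded_measurable B f ->
  mu.-integrable setT (EFin \o f).
Proof.
move=> [mf fB]; apply: measurable_bounded_integrable => //.
  by rewrite [ltLHS]mu1 ltry.
by exists B; split=> [|M BM x _]; [exact: num_real|exact: le_trans (fB x) (ltW BM)].
Qed.

Lemma mean_EFin B f : bounded_measurable B f ->
  (\int[mu]_x f x)%:E = (\int[mu]_x (f x)%:E)%E.
Proof.
move=> bf; rewrite fineK//; apply: integrable_fin_num => //.
exact: bounded_measurable_integrable bf.
Qed.

Lemma mean_cst r : \int[mu]_x cst r x = r.
Proof. by rewrite Rintegral_cst// mu1 mulr1. Qed.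

Lemma le_norm_mean B f : bounded_measurable B f -> `|\int[mu]_x f x| <= B.
Proof.
move=> bf; have [mf fB] := bf.
apply: (le_trans (le_normr_Rintegral measurableT (bounded_measurable_integrable bf))).
have B0 := bounded_measurable_ge0 bf.
rewrite -[leRHS]mean_cst.
apply: le_Rintegral => //; apply: (@bounded_measurable_integrable B).
- by split=> [|x]; [exact: measurableT_comp|rewrite normr_id].
- by split=> [|x]; [exact: measurable_cst|rewrite ger0_norm].
Qed.

Lemma meanB B C f g : bounded_measurable B f -> bounded_measurable C g ->
  \int[mu]_x (f x - g x) = \int[mu]_x f x - \int[mu]_x g x.
Proof. by move=> bf bg; apply: RintegralB => //;
  [exact: bounded_measurable_integrable bf|exact: bounded_measurable_integrable bg]. Qed.

Lemma mean_sum B (I : Type) (s : seq I) (w : I -> R) (g : I -> X -> R) :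
  (forall i, bounded_measurable B (g i)) ->
  \int[mu]_x (\sum_(i <- s) w i * g i x) = \sum_(i <- s) w i * \int[mu]_x g i x.
Proof.
move=> bg; elim: s => [|i s ih].
  by under eq_Rintegral do rewrite big_nil; rewrite big_nil (mean_cst 0).
under eq_Rintegral do rewrite big_cons.
rewrite big_cons -ih RintegralD//.
- by rewrite RintegralZl//; exact: bounded_measurable_integrable (bg i).
- exact: bounded_measurable_integrable (bounded_measurableZ _ (bg i)).
- exact: bounded_measurable_integrable (bounded_measurable_sum s w bg).
Qed.

End bounded_measurable.

Section mean.
Context (dX : measure_display) (X : measurableType dX) (R : realType).
Variable mu : {measure set X -> \bar R}.
Hypothesis mu1 : mu setT = 1%E.
Implicit Types (f g : X -> R).

Lemma bounded_measurableD B C f g : bounded_measurable B f ->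
  bounded_measurable C g -> bounded_measurable (B + C) (f \+ g).
Proof.
move=> [mf fB] [mg gC]; split; first exact: measurable_funD.
by move=> x /=; apply: (le_trans (ler_normD _ _)); exact: lerD.
Qed.

Lemma bounded_measurableM B C f g : bounded_measurable B f ->
  bounded_measurable C g -> bounded_measurable (B * C) (f \* g).
Proof.
move=> [mf fB] [mg gC]; split; first exact: measurable_funM.
by move=> x /=; rewrite normrM ler_pM.
Qed.

Lemma bounded_measurable_norm B f : bounded_measurable B f ->
  bounded_measurable B (fun x => `|f x|).
Proof.
move=> [mf fB]; split; first exact: measurableT_comp.
by move=> x; rewrite normr_id.
Qed.

Lemma bounded_measurable_dist B C f g : bounded_measurable B f ->
  bounded_measurable C g -> bounded_measurable (B + C) (fun x => `|f x - g x|).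
Proof. by move=> bf bg; exact: bounded_measurable_norm (bounded_measurableB bf bg). Qed.

Lemma le_mean B C f g : bounded_measurable B f -> bounded_measurable C g ->
  (forall x, f x <= g x) -> \int[mu]_x f x <= \int[mu]_x g x.
Proof.
move=> bf bg fg; apply: le_Rintegral => //.
  exact: (bounded_measurable_integrable mu1 bf).
exact: (bounded_measurable_integrable mu1 bg).
Qed.

Lemma meanD B C f g : bounded_measurable B f -> bounded_measurable C g ->
  \int[mu]_x (f x + g x) = \int[mu]_x f x + \int[mu]_x g x.
Proof.
by move=> bf bg; rewrite (RintegralD measurableT (bounded_measurable_integrable mu1 bf)
  (bounded_measurable_integrable mu1 bg)).
Qed.

Lemma meanZ B f r : bounded_measurable B f ->
  \int[mu]_x (r * f x) = r * \int[mu]_x f x.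
Proof.
by move=> bf; rewrite (RintegralZl _ measurableT (bounded_measurable_integrable mu1 bf)).
Qed.

Lemma mean_dist_triangle B C D f g h : bounded_measurable B f -> bounded_measurable C g ->
  bounded_measurable D h ->
  \int[mu]_x `|f x - h x| <= \int[mu]_x `|f x - g x| + \int[mu]_x `|g x - h x|.
Proof.
move=> bf bg bh.
have bfg := bounded_measurable_dist bf bg.
have bgh := bounded_measurable_dist bg bh.
rewrite -(meanD bfg bgh).
apply: (le_mean (bounded_measurable_dist bf bh) (bounded_measurableD bfg bgh)) => x.
exact: ler_distD.
Qed.

Lemma mean_dist_ge B C f g : bounded_measurable B f -> bounded_measurable C g ->
  `|\int[mu]_x f x - \int[mu]_x g x| <= \int[mu]_x `|f x - g x|.
Proof.
move=> bf bg; rewrite -(meanB mu1 bf bg); apply: le_normr_Rintegral => //.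
exact: (bounded_measurable_integrable mu1 (bounded_measurableB bf bg)).
Qed.

End mean.

Lemma bounded_measurable_comp (dX dY : measure_display) (X : measurableType dX)
    (Y : measurableType dY) (R : realType) (pi : X -> Y) (B : R) (f : Y -> R) :
  measurable_fun setT pi -> bounded_measurable B f -> bounded_measurable B (f \o pi).
Proof. by move=> mpi [mf fB]; split=> [|x]; [exact: measurableT_comp|exact: fB]. Qed.

(** * Markov semigroups and their time derivatives *)

Section semigroup.
Context (dX : measure_display) (X : measurableType dX) (R : realType).
Variable P : R -> R.-pker X ~> X.
Implicit Types (f g : X -> R).
Hypothesis P0 : forall x A, measurable A -> P 0 x A = \d_x A.
Hypothesis PD : forall (s t : R) x A, 0 <= s -> 0 <= t -> measurable A ->
  P (s + t) x A = (\int[P s x]_y P t y A)%E.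

Let P1 t x : P t x setT = 1%E. Proof. exact: prob_kernel. Qed.

Lemma bounded_measurable_semigroup B f t :
  bounded_measurable B f -> bounded_measurable B (semigroup P t f).
Proof.
move=> bf; have [mf fB] := bf; split; last first.
  by move=> x; apply: le_norm_mean => //; exact: prob_kernel.
(* Passing to [B - f] makes the integrand nonnegative, as measurability of a kernel integral in the
   starting point requires. *)
have -> : semigroup P t f = fun x => fine (\int[P t x]_y (B - f y)%:E)%E * -1 + B.
  apply/funext => x; have -> : fine (\int[P t x]_y (B - f y)%:E)%E =
    \int[P t x]_y (cst B y - f y) by [].
  rewrite (meanB (P1 _ _) (B := `|B|) (C := B))// ?mean_cst//.
  by rewrite mulrN1 opprB subrK.
apply: measurable_funD => //; apply: measurable_funM => //.
apply: measurableT_comp => //.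
apply: measurable_fun_integral_kernel.
- by move=> U mU; exact: measurable_kernel.
- by move=> y; rewrite lee_fin subr_ge0 (le_trans (ler_norm _)).
- by apply/measurable_EFinP; exact: measurable_funB.
Qed.

Lemma semigroup_bound B f t x : bounded_measurable B f -> `|semigroup P t f x| <= B.
Proof. by move=> /(bounded_measurable_semigroup t)[_ ->]. Qed.

Lemma semigroup0 f : measurable_fun setT f -> semigroup P 0 f = f.
Proof.
move=> mf; apply/funext => x; rewrite /semigroup /Rintegral.
rewrite (eq_measure_integral (dirac x)); last by move=> A mA _; rewrite P0.
by rewrite integral_dirac// ?diracT ?mul1e//; exact/measurable_EFinP.
Qed.

Let semigroupD_ge0 B f (s t : R) x : 0 <= s -> 0 <= t -> bounded_measurable B f ->
  (forall y, 0 <= f y) -> semigroup P (s + t) f x = semigroup P s (semigroup P t f) x.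
Proof.
move=> s0 t0 bf f0; rewrite /semigroup /Rintegral; congr fine.
have mf : measurable_fun setT (EFin \o f) by apply/measurable_EFinP; exact: bf.1.
rewrite (eq_measure_integral (kcomp (P s) (kernel.kernel_snd (T0 := X) (P t)) x));
  last first.
  by move=> A mA _; rewrite PD.
have f0' y : (0 <= (EFin \o f) y)%E by rewrite lee_fin.
rewrite (integral_kcomp _ _ _ f0' mf).
by apply: eq_integral => y _; exact/esym/(mean_EFin (P1 t y) bf).
Qed.

Let semigroup_cstB B f t : bounded_measurable B f ->
  semigroup P t (fun y => B - f y) = fun y => B - semigroup P t f y.
Proof.
move=> bf; apply/funext => y; have B0 := bounded_measurable_ge0 bf.
have cB : bounded_measurable B (fun _ : X => B) by split=> // z; rewrite ger0_norm.
by rewrite {1}/semigroup (meanB (P1 _ _) cB bf) (mean_cst (P1 _ _) B).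
Qed.

Lemma semigroupD B f (s t : R) : 0 <= s -> 0 <= t -> bounded_measurable B f ->
  semigroup P (s + t) f = semigroup P s (semigroup P t f).
Proof.
move=> s0 t0 bf; apply/funext => x; have B0 := bounded_measurable_ge0 bf.
have cB : bounded_measurable B (fun _ : X => B) by split=> // y; rewrite ger0_norm.
have := @semigroupD_ge0 (B + B) (fun y => B - f y) s t x s0 t0
  (bounded_measurableB cB bf).
rewrite !(semigroup_cstB _ bf) (semigroup_cstB _ (bounded_measurable_semigroup t bf)).
move=> h; apply: (@subrI _ B); apply: h => y.
by rewrite subr_ge0 (le_trans (ler_norm _))//; exact: bf.2.
Qed.

Lemma generates_near f g (e : R) : generates P f g -> 0 < e ->
  \forall h \near 0^'+, forall x, `|h^-1 * (semigroup P h f x - f x) - g x| <= e.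
Proof.
move=> h e0.
have : nbhs (g : {uniform X -> R}) [set u | forall x, `|u x - g x| <= e].
  apply/uniform_nbhs; exists [set xy | ball xy.1 e xy.2]; split.
    by rewrite -entourage_ballE; exists e.
  by move=> u /= hu x; rewrite distrC; apply: ltW; exact: (hu x).
by move=> /h.
Qed.

(** For small [h] the difference quotient is at most [B + 1], so the increment is at most
    [(B + 1) h], uniformly in the starting point. *)
Lemma generates_strongly_continuous B f g (e : R) : bounded_measurable B g ->
  generates P f g -> 0 < e ->
  \forall h \near 0^'+, forall x, `|semigroup P h f x - f x| <= e.
Proof.
move=> bg fg e0; have B0 := bounded_measurable_ge0 bg.
near=> h => x.
have h0 : 0 < h by near: h; exact: nbhs_right_gt.
have hb : `|h^-1 * (semigroup P h f x - f x)| <= B + 1.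
  rewrite -[X in `|X|](subrK (g x)) (le_trans (ler_normD _ _))// addrC.
  apply: lerD; first exact: bg.2.
  by move: x; near: h; exact: generates_near.
have he : h <= e / (B + 1) by near: h; apply: nbhs_right_le; rewrite divr_gt0// ltr_wpDl.
rewrite normrM gtr0_norm ?invr_gt0// mulrC ler_pdivrMr// in hb.
apply: (le_trans hb); rewrite mulrC -ler_pdivlMr//.
by rewrite ltr_wpDl.
Unshelve. all: by end_near. Qed.

(** The generator only gives a right derivative at time 0. For [h < 0] the quotient is an average
    under the law at time [h + s], while the limit is taken at time [s]; writing [S_s g] as
    [S_(h+s) S_(-h) g] compares the two, and this is where strong continuity at [g] enters. *)
Lemma is_derive_semigroup B C f g : bounded_measurable B f -> bounded_measurable C g ->
  generates P f g ->
  (forall e : R, 0 < e ->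
    \forall h \near 0^'+, forall x, `|semigroup P h g x - g x| <= e) ->
  forall (s : R) x, 0 < s ->
    is_derive s 1 (fun t => semigroup P t f x) (semigroup P s g x).
Proof.
move=> bf bg fg cg s x s0.
suff : h^-1 *: (semigroup P (h *: 1 + s) f x - semigroup P s f x) @[h --> 0^'] -->
    semigroup P s g x.
  move=> h; split; last exact: cvg_lim h.
  by apply/cvg_ex; exists (semigroup P s g x).
have bq h : bounded_measurable (`|h^-1| * (B + B))
    (fun y => h^-1 * (semigroup P h f y - f y)).
  exact: bounded_measurableZ (bounded_measurableB (bounded_measurable_semigroup h bf) bf).
(* Both one-sided difference quotients at [s] are averages of
   [h^-1 * (S_h f - f)]. *)
have incr r h : 0 <= r -> 0 < h -> h^-1 * (semigroup P (r + h) f x - semigroup P r f x) =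
    semigroup P r (fun y => h^-1 * (semigroup P h f y - f y)) x.
  move=> r0 h0; rewrite (semigroupD r0 (ltW h0) bf).
  rewrite [in RHS]/semigroup RintegralZl//.
    by rewrite (meanB (P1 _ _) (bounded_measurable_semigroup h bf) bf).
  exact: (bounded_measurable_integrable (P1 _ _)
    (bounded_measurableB (bounded_measurable_semigroup h bf) bf)).
have le_mean r u v e B1 B2 : bounded_measurable B1 u -> bounded_measurable B2 v ->
    (forall y, `|u y - v y| <= e) -> `|semigroup P r u x - semigroup P r v x| <= e.
  move=> bu bv uv; rewrite /semigroup -(meanB (P1 _ _) bu bv).
  by apply: le_norm_mean; [exact: P1|split => //; exact: measurable_funB bu.1 bv.1].
apply/cvgrPdist_le => e e0.
have e20 : 0 < e / 2 by rewrite divr_gt0.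
have [d1 /= d10 hd1] := generates_near fg e20.
have [d2 /= d20 hd2] := cg _ e20.
near=> h.
have h0 : h != 0 by near: h; exact: nbhs_dnbhs_neq.
have hd : `|h| < d1 /\ `|h| < d2 /\ `|h| < s.
  by split; [|split]; near: h; apply: dnbhs0_lt.
have sm k (k0 : 0 < k) : k = `|h| -> forall y,
    `|k^-1 * (semigroup P k f y - f y) - g y| <= e / 2 /\ `|semigroup P k g y
      - g y| <= e / 2.
  move=> kh y; split; [apply: hd1|apply: hd2] => //=.
    by rewrite sub0r normrN gtr0_norm// kh; case: hd.
  by rewrite sub0r normrN gtr0_norm// kh; case: hd => _ [].
rewrite distrC /GRing.scale/= mulr1.
have [h_gt0|] := ltP 0 h.
  rewrite [h + s]addrC (incr s h (ltW s0) h_gt0).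
  apply: (@le_trans _ _ (e / 2)); last by rewrite ler_pdivrMr// ler_pMr// ler1n.
  apply: le_mean (bq h) bg _ => y; have [|//] := sm h h_gt0 _ y.
  by rewrite gtr0_norm.
rewrite le_eqVlt (negbTE h0)/= => h_lt0.
have k0 : 0 < - h by rewrite oppr_gt0.
have hs : 0 <= h + s.
  have [_ [_]] := hd; rewrite (ltr0_norm h_lt0) => hs.
  have hs' : - h <= s by exact: ltW.
  by rewrite -(opprK h) addrC subr_ge0.
have -> : h^-1 * (semigroup P (h + s) f x - semigroup P s f x) =
    semigroup P (h + s) (fun y => (- h)^-1 * (semigroup P (- h) f y - f y)) x.
  by rewrite -incr// addrAC subrr add0r invrN mulNr -mulrN opprB.
have -> : semigroup P s g = semigroup P (h + s) (semigroup P (- h) g).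
  by rewrite -(semigroupD hs (ltW k0) bg) addrAC subrr add0r.
apply: le_mean (bq _) (bounded_measurable_semigroup _ bg) _ => y.
have [|u v] := sm (- h) k0 _ y; first by rewrite ltr0_norm.
rewrite -(subrKA (g y)) (le_trans (ler_normD _ _))// [leRHS]splitr lerD//.
by rewrite distrC.
Unshelve. all: by end_near. Qed.

Lemma continuous_semigroup B C f g : bounded_measurable B f -> bounded_measurable C g ->
  generates P f g ->
  (forall e : R, 0 < e ->
    \forall h \near 0^'+, forall x, `|semigroup P h g x - g x| <= e) ->
  forall (T : R) x, {within `[0, T], continuous (fun t => semigroup P t f x)}.
Proof.
move=> bf bg fg cg T x.
(* The enlarged interval is nondegenerate whatever the sign of [T]. *)
have T1 : 0 < `|T| + 1 by rewrite ltr_wpDl.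
have sub : `[0, T]%classic `<=` `[0, `|T| + 1]%classic.
  by apply: subset_itvl; rewrite !bnd_simp (le_trans (ler_norm _))// lerDl.
apply: (continuous_subspaceW sub).
have cs (s : R) : 0 < s -> (semigroup P t f x) @[t --> s] --> semigroup P s f x.
  move=> s0; have dS := is_derive_semigroup bf bg fg cg x s0.
  by apply: differentiable_continuous; apply/derivable1_diffP; exact: ex_derive.
apply/continuous_within_itvP => //; split.
- by move=> s; rewrite in_itv/= => /andP[s0 _]; exact: cs.
- rewrite (semigroup0 bf.1); apply/cvgrPdist_le => e e0.
  near=> h; rewrite distrC.
  have hx : forall x, `|semigroup P h f x - f x| <= e.
    by near: h; exact: generates_strongly_continuous bg fg e0.
  exact: hx.
- by apply: cvg_at_left_filter; exact: cs.
Unshelve. all: by end_near. Qed.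

End semigroup.

(** * Finite-range jump dynamics *)

Section edges.
Variables (d : nat) (R : realType) (p : site d -> site d -> R).
Hypothesis hp : nn_kernel p.
Implicit Types (A : {fset site d}) (x y z : site d).

Lemma kernel_ge0 x y : 0 <= p x y. Proof. by have [p0 _ _ _] := hp. Qed.

Lemma kernelE x y : p x y = p 0 (y - x). Proof. by have [_ _ pE _] := hp. Qed.

(** A finite-support sum takes the default value 0 when its support is infinite, whereas the row of
    [p] at the origin sums to 1. *)
Lemma finite_range : finite_set [set z | p 0 z != 0].
Proof.
have [_ p1 _ _] := hp; apply: contrapT => fin; have /eqP := p1 0.
rewrite fsbig_dflt; first by rewrite eq_sym oner_eq0.
by move=> fin'; apply: fin; apply: sub_finite_set fin' => z /eqP; split.
Qed.

Definition range_set : {fset site d} := fset_set [set z | p 0 z != 0].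

Lemma in_range_set z : (z \in range_set) = (p 0 z != 0).
Proof. by rewrite (in_fset_set finite_range); apply/idP/idP; rewrite inE. Qed.

Lemma sum_range_set : \sum_(z <- range_set) p 0 z = 1.
Proof.
have [_ p1 _ _] := hp; rewrite -(p1 0); apply/esym/fsbigTE => z.
by rewrite in_range_set negbK => /eqP.
Qed.

Let edge_seq A := [seq (x, x + z) | x <- A, z <- range_set] ++
                  [seq (y - z, y) | y <- A, z <- range_set].

Definition edges A : {fset site d * site d} := [fset e in edge_seq A]%fset.

Lemma in_edges A x y : p x y != 0 -> (x \in A) || (y \in A) -> (x, y) \in edges A.
Proof.
rewrite kernelE -in_range_set => pxy xyA; rewrite in_fset/= mem_cat; apply/orP.
case/orP: xyA => xyA; [left|right]; apply/allpairsP.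
  by exists (x, y - x); split=> //=; rewrite addrC subrK.
by exists (y, y - x); split=> //=; rewrite opprB addrC subrK.
Qed.

Lemma edges_touch A x y : (x, y) \in edges A -> (x \in A) || (y \in A).
Proof.
by rewrite in_fset/= mem_cat => /orP[] /allpairsP[[u v] [/= uA _ [-> ->]]];
  rewrite uA ?orbT.
Qed.

(** Each site has total outgoing rate 1 and, by translation invariance, total incoming rate 1. An
    edge with both ends in [A] is listed more than once in [edge_seq], and removing repetitions only
    lowers the sum. *)
Lemma sum_edges A : \sum_(e <- edges A) p e.1 e.2 <= 2 * #|` A|%:R.
Proof.
have undup_le (s : seq (site d * site d)) :
    \sum_(e <- undup s) p e.1 e.2 <= \sum_(e <- s) p e.1 e.2.
  elim: s => //= e s ih; case: ifP => _; rewrite ?big_cons ?lerD2l//.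
  by rewrite (le_trans ih)// lerDr kernel_ge0.
rewrite (perm_big (undup (edge_seq A))); last first.
  by apply: uniq_perm; rewrite ?undup_uniq ?fset_uniq// => e; rewrite mem_undup in_fset.
apply: (le_trans (undup_le _)).
rewrite big_cat/= !big_allpairs_dep/= mulr_natr mulr2n mulrnDl cardfE.
have cnt : \sum_(x <- A) (1 : R) = #|`A|%:R.
  by rewrite big_const_seq count_predT iter_addr_0.
rewrite -cardfE -cnt; apply: lerD; apply: ler_sum => x _; rewrite -sum_range_set;
  apply: ler_sum => z _.
  by rewrite kernelE addrAC subrr add0r.
by rewrite kernelE opprB addrC subrK.
Qed.

End edges.

Section jump_generator.
Variables (d : nat) (R : realType) (p : site d -> site d -> R).
Hypothesis hp : nn_kernel p.
Context (dX : measure_display) (X : measurableType dX).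
Variables (agree : site d -> X -> X -> Prop) (T : site d -> site d -> X -> X).
Hypothesis mT : forall x y, measurable_fun setT (T x y).
Hypothesis agreeT : forall x y z u, z != x -> z != y -> agree z (T x y u) u.
Hypothesis T_agree : forall x y z u v, agree x u v -> agree y u v ->
  agree z u v -> agree z (T x y u) (T x y v).
Implicit Types (A : {fset site d}) (f : X -> R).

(** [agree] and [T] stay abstract so that one development serves both single configurations with
    [attempt] and coupled pairs with [attempt2]. *)
Definition depends_on A f :=
  forall u v, (forall x, x \in A -> agree x u v) -> f u = f v.

Definition jump_gen f : X -> R := fun u =>
  \sum_(e \in [set: site d * site d]) p e.1 e.2 * (f (T e.1 e.2 u) - f u).

Definition jump_diff f (e : site d * site d) : X -> R := fun u => f (T e.1 e.2 u) - f u.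

Lemma jump_diff0 A f x y : depends_on A f -> x \notin A -> y \notin A ->
  jump_diff f (x, y) = cst 0.
Proof.
move=> fA xA yA; apply/funext => u; apply/eqP; rewrite subr_eq0; apply/eqP.
by apply: fA => z zA; apply: agreeT; [apply: contraNneq xA|apply: contraNneq yA] => /= <-.
Qed.

Lemma jump_genE A f : depends_on A f ->
  jump_gen f = fun u => \sum_(e <- edges p A) p e.1 e.2 * jump_diff f e u.
Proof.
move=> fA; apply/funext => u; apply: fsbigTE => -[x y] /= xyA.
have [->|pxy] := eqVneq (p x y) 0; first by rewrite mul0r.
have : ~~ ((x \in A) || (y \in A)).
  by apply: contra xyA; exact: in_edges.
rewrite negb_or => /andP[xA yA].
by have /(congr1 (@^~ u)) := jump_diff0 fA xA yA; rewrite /jump_diff/= => ->; rewrite mulr0.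
Qed.

Lemma depends_on_jump_diff A f x y :
  depends_on A f -> depends_on (x |` (y |` A))%fset (jump_diff f (x, y)).
Proof.
move=> fA u v uv; rewrite /jump_diff/=; congr (_ - _); apply: fA => z zA.
  by apply: T_agree; apply: uv; rewrite !inE ?eqxx ?orbT// zA !orbT.
by apply: uv; rewrite !inE zA !orbT.
Qed.

(** An edge that touches [A] brings in at most one new site, so the support grows by at most one per
    application of the generator. *)
Lemma card_edge A x y : (x \in A) || (y \in A) ->
  (#|` (x |` (y |` A))%fset| <= #|` A|.+1)%N.
Proof.
move=> xyA; rewrite cardfsU1; case/orP: xyA => h.
  by rewrite !inE h orbT add0n cardfsU1 -[leqRHS]add1n leq_add// leq_b1.
by rewrite (mem_fset1U h) -[leqRHS]add1n leq_add// leq_b1.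
Qed.

Lemma bounded_measurable_jump_diff B f e :
  bounded_measurable B f -> bounded_measurable (2 * B) (jump_diff f e).
Proof.
move=> [mf fB]; split.
  by apply: measurable_funB => //; apply: measurableT_comp => //; exact: mT.
by move=> u; rewrite mulr_natl mulr2n (le_trans (ler_normB _ _))// lerD.
Qed.

Lemma depends_on_jump_gen A f : depends_on A f ->
  exists A', depends_on A' (jump_gen f).
Proof.
move=> fA; pose A' := (\bigcup_(e <- edges p A) (e.1 |` (e.2 |` A)))%fset;
  exists A' => u v uv.
rewrite (jump_genE fA); rewrite big_seq [RHS]big_seq; apply: eq_bigr => -[x y] xyA.
congr (_ * _); apply: (depends_on_jump_diff fA) => z zxy; apply: uv.
by apply/bigfcupP; exists (x, y) => //; rewrite xyA.
Qed.

Lemma bounded_measurable_jump_gen A B f : depends_on A f -> bounded_measurable B f ->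
  exists C, bounded_measurable C (jump_gen f).
Proof.
move=> fA bf; rewrite (jump_genE fA); eexists.
by apply: bounded_measurable_sum => e; exact: bounded_measurable_jump_diff bf.
Qed.

(** [V] is an additional property of the test functions that jump differences preserve: trivial when
    two evolutions are compared, vanishing on an invariant set in [semigroup_eq0]. *)
Definition jump_class (V : (X -> R) -> Prop) m B f :=
  exists A, [/\ (#|` A| <= m)%N, depends_on A f, bounded_measurable B f & V f].

Lemma jump_class_diff V m B f :
  (forall f x y, V f -> V (jump_diff f (x, y))) ->
  jump_class V m B f -> exists A, [/\ (#|` A| <= m)%N, depends_on A f &
    forall e, e \in edges p A -> jump_class V m.+1 (2 * B) (jump_diff f e)].
Proof.
move=> VV [A [Am fA bf Vf]]; exists A; split=> // -[x y] /edges_touch xyA.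
exists (x |` (y |` A))%fset; split; last exact: VV.
- exact: leq_trans (card_edge xyA) _.
- exact: depends_on_jump_diff.
- exact: bounded_measurable_jump_diff.
Qed.

End jump_generator.

(** * Time regularity of the evolution of functions of finitely many sites *)

Section jump_semigroup.
Variables (d : nat) (R : realType) (p : site d -> site d -> R).
Hypothesis hp : nn_kernel p.
Context (dY : measure_display) (Y : measurableType dY).
Variables (agree : site d -> Y -> Y -> Prop) (T : site d -> site d -> Y -> Y).
Hypothesis mT : forall x y, measurable_fun setT (T x y).
Hypothesis agreeT : forall x y z u, z != x -> z != y -> agree z (T x y u) u.
Hypothesis T_agree : forall x y z u v, agree x u v -> agree y u v ->
  agree z u v -> agree z (T x y u) (T x y v).
Context (dX : measure_display) (X : measurableType dX) (pi : X -> Y).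
Hypothesis mpi : measurable_fun setT pi.
Variable Q : R -> R.-pker X ~> X.
Hypothesis Q0 : forall x A, measurable A -> Q 0 x A = \d_x A.
Hypothesis QD : forall (s t : R) x A, 0 <= s -> 0 <= t -> measurable A ->
  Q (s + t) x A = (\int[Q s x]_y Q t y A)%E.
Local Notation dep := (depends_on agree).
Local Notation jump := (jump_gen p T).
Hypothesis Qgen : forall A f, dep A f -> generates Q (f \o pi) (jump f \o pi).

(** [jump f] again depends on finitely many sites, so it has a bounded generator image itself. *)
Let strong A B f : dep A f -> bounded_measurable B f -> forall e : R, 0 < e ->
  \forall h \near 0^'+, forall x,
    `|semigroup Q h (jump f \o pi) x - (jump f \o pi) x| <= e.
Proof.
move=> fA bf e e0.
have [A' A'f] := depends_on_jump_gen hp agreeT T_agree fA.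
have [C bC] := bounded_measurable_jump_gen hp mT agreeT fA bf.
have [D bD] := bounded_measurable_jump_gen hp mT agreeT A'f bC.
exact: generates_strongly_continuous (bounded_measurable_comp mpi bD) (Qgen A'f) e0.
Qed.

Lemma jump_semigroup_continuous A B f t0 x : dep A f -> bounded_measurable B f ->
  {within `[0, t0], continuous (fun t => semigroup Q t (f \o pi) x)}.
Proof.
move=> fA bf; have [C bC] := bounded_measurable_jump_gen hp mT agreeT fA bf.
have := continuous_semigroup Q0 QD (bounded_measurable_comp mpi bf)
  (bounded_measurable_comp mpi bC)
  (Qgen fA) (strong fA bf).
exact.
Qed.

Lemma is_derive_semigroup_jump_gen A B f (s : R) x : dep A f -> bounded_measurable B f ->
  0 < s -> is_derive s 1 (fun t => semigroup Q t (f \o pi) x)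
    (semigroup Q s (jump f \o pi) x).
Proof.
move=> fA bf s0; have [C bC] := bounded_measurable_jump_gen hp mT agreeT fA bf.
exact: (is_derive_semigroup QD (bounded_measurable_comp mpi bf)
  (bounded_measurable_comp mpi bC)
  (Qgen fA) (strong fA bf)).
Qed.

Lemma is_derive_jump_semigroup A B f (s : R) x : dep A f -> bounded_measurable B f ->
  0 < s -> is_derive s 1 (fun t => semigroup Q t (f \o pi) x)
    (\sum_(e <- edges p A) p e.1 e.2 * semigroup Q s (jump_diff T f e \o pi) x).
Proof.
move=> fA bf s0.
have bj e : bounded_measurable (2 * B) (jump_diff T f e \o pi).
  by apply: (bounded_measurable_comp mpi); exact: bounded_measurable_jump_diff.
have Q1 : Q s x setT = 1%E by exact: prob_kernel.
rewrite -(mean_sum Q1 (edges p A) (fun e => p e.1 e.2) bj).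
by have := is_derive_semigroup_jump_gen x fA bf s0; rewrite (jump_genE hp agreeT fA).
Qed.

End jump_semigroup.

(** * Uniqueness of the evolution *)

Section jump_uniqueness.
Variables (d : nat) (R : realType) (p : site d -> site d -> R).
Hypothesis hp : nn_kernel p.
Context (dY : measure_display) (Y : measurableType dY).
Variables (agree : site d -> Y -> Y -> Prop) (T : site d -> site d -> Y -> Y).
Hypothesis mT : forall x y, measurable_fun setT (T x y).
Hypothesis agreeT : forall x y z u, z != x -> z != y -> agree z (T x y u) u.
Hypothesis T_agree : forall x y z u v, agree x u v -> agree y u v ->
  agree z u v -> agree z (T x y u) (T x y v).
Variable P : R -> R.-pker Y ~> Y.
Hypothesis P0 : forall x A, measurable A -> P 0 x A = \d_x A.
Hypothesis PD : forall (s t : R) x A, 0 <= s -> 0 <= t -> measurable A ->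
  P (s + t) x A = (\int[P s x]_y P t y A)%E.
Local Notation dep := (depends_on agree).
Local Notation jump := (jump_gen p T).
Hypothesis Pgen : forall A f, dep A f -> generates P f (jump f).

Let P_cont A B f t0 x : dep A f -> bounded_measurable B f ->
  {within `[0, t0], continuous (fun t => semigroup P t f x)}.
Proof.
by move=> fA bf; exact: (jump_semigroup_continuous hp mT agreeT T_agree
  (@measurable_id _ Y setT) P0 PD Pgen fA bf).
Qed.

Let P_derive A B f (s : R) x : dep A f -> bounded_measurable B f -> 0 < s ->
  is_derive s 1 (fun t => semigroup P t f x)
    (\sum_(e <- edges p A) p e.1 e.2 * semigroup P s (jump_diff T f e) x).
Proof.
by move=> fA bf s0; exact:
  (@is_derive_jump_semigroup _ _ _ hp _ _ _ _ mT agreeT T_agree _ _ _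
  (@measurable_id _ Y setT) _ PD Pgen A B f s x fA bf s0).
Qed.

Let sum_edges_le A m : (#|` A| <= m)%N -> \sum_(e <- edges p A) p e.1 e.2 <= 2 * m%:R.
Proof. by move=> Am; rewrite (le_trans (sum_edges hp A))// ler_pM2l// ler_nat. Qed.

(** Functions vanishing on [D] are stable under jump differences when [D] is stable under jumps, so
    [S_t f u] satisfies a closed hierarchy with value 0 at time 0. With [D] the pairs having at most
    one discrepancy, this shows that no second discrepancy is created. *)
Theorem semigroup_eq0 (D : set Y) : (forall x y u, D u -> D (T x y u)) ->
  forall A B f (t : R) u, dep A f -> bounded_measurable B f ->
  (forall v, D v -> f v = 0) -> D u -> 0 <= t -> semigroup P t f u = 0.
Proof.
move=> DT A B f t u fA bf f0 Du t0.
pose V (f : Y -> R) := forall v, D v -> f v = 0.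
have VV g x y : V g -> V (jump_diff T g (x, y)).
  by move=> Vg v Dv; rewrite /jump_diff/= !Vg ?subrr//; exact: DT.
apply: (hierarchy_eq0 (I := (site d * site d)%type)
  (Cl := jump_class agree V) (Phi := fun t f => semigroup P t f u) _ _ _ _ _
  (m := #|` A|) (B := B)) => //.
- by move=> m B' g [A' [_ _ bg _]]; exact: bounded_measurable_ge0 bg.
- move=> m B' g s [A' [_ _ bg _]] s0; rewrite (le_trans (semigroup_bound _ _ _ bg))//.
  by rewrite ler_peMl ?ler1n//; exact: bounded_measurable_ge0 bg.
- by move=> m B' g t1 [A' [_ gA' bg _]]; exact: P_cont gA' bg.
- move=> m B' g Cg; have [A' [A'm gA' bg Vg]] := Cg.
  have [A'' [A''m gA'' Cd]] := jump_class_diff p mT T_agree VV Cg.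
  exists (edges p A''), (fun e => p e.1 e.2), (jump_diff T g); split => //.
  + by move=> e _; exact: kernel_ge0.
  + exact: sum_edges_le.
  + by move=> s s0; exact: P_derive gA'' bg s0.
- move=> m B' g [A' [_ _ bg Vg]]; rewrite (semigroup0 P0 bg.1); exact: Vg.
- by exists A; split.
Qed.

Context (dX : measure_display) (X : measurableType dX) (pi : X -> Y).
Hypothesis mpi : measurable_fun setT pi.
Variable Q : R -> R.-pker X ~> X.
Hypothesis Q0 : forall x A, measurable A -> Q 0 x A = \d_x A.
Hypothesis QD : forall (s t : R) x A, 0 <= s -> 0 <= t -> measurable A ->
  Q (s + t) x A = (\int[Q s x]_y Q t y A)%E.
Hypothesis Qgen : forall A f, dep A f -> generates Q (f \o pi) (jump f \o pi).

(** The two sides satisfy the same hierarchy and agree at time 0. The map [pi] is a coordinate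
    projection for the marginals of the coupling, and a translation, with the coupling on both
    sides, for its covariance. *)
Theorem semigroup_comp A B f (t : R) x : dep A f -> bounded_measurable B f -> 0 <= t ->
  semigroup Q t (f \o pi) x = semigroup P t f (pi x).
Proof.
move=> fA bf t0; apply/eqP; rewrite -subr_eq0; apply/eqP.
apply: (hierarchy_eq0 (I := (site d * site d)%type)
  (Cl := jump_class agree (fun=> True))
  (Phi := fun t f => semigroup Q t (f \o pi) x - semigroup P t f (pi x)) _ _ _ _ _
  (m := #|` A|) (B := B)) => //.
- by move=> m B' g [A' [_ _ bg _]]; exact: bounded_measurable_ge0 bg.
- move=> m B' g s [A' [_ _ bg _]] s0; rewrite mulr_natl mulr2n (le_trans (ler_normB _ _))//.
  apply: lerD; first exact: semigroup_bound (bounded_measurable_comp mpi bg).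
  exact: semigroup_bound bg.
- move=> m B' g t1 [A' [_ gA' bg _]] s; apply: cvgB.
    exact: (jump_semigroup_continuous hp mT agreeT T_agree mpi Q0 QD Qgen gA' bg).
  exact: (P_cont gA' bg).
- move=> m B' g Cg; have [A' [A'm gA' bg _]] := Cg.
  have [A'' [A''m gA'' Cd]] := jump_class_diff p mT T_agree (fun _ _ _ _ => I) Cg.
  exists (edges p A''), (fun e => p e.1 e.2), (jump_diff T g); split => //.
  + by move=> e _; exact: kernel_ge0.
  + exact: sum_edges_le.
  + move=> s s0; under eq_bigr do rewrite mulrBr; rewrite sumrB.
    apply: is_deriveB; last exact: P_derive gA'' bg s0.
    exact: (is_derive_jump_semigroup hp mT agreeT T_agree mpi QD Qgen _ gA'' bg s0).
- move=> m B' g [A' [_ _ bg Vg]].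
  by rewrite (semigroup0 P0 bg.1) (semigroup0 Q0 (bounded_measurable_comp mpi bg).1) subrr.
- by exists A; split.
Qed.

End jump_uniqueness.

(** * Attempted jumps and discrepancies *)

Section attempts.
Variable d : nat.
Implicit Types (eta xi : conf d) (x y z k i : site d).

(* A jump from [x] to [y] sorts the pair of occupation numbers at [x], [y]. *)
Lemma attemptE x y eta z : attempt x y eta z =
  if z == x then eta x && eta y else if z == y then eta x || eta y else eta z.
Proof.
rewrite /attempt /exchange; case: eqVneq => [->|zx].
  by case Ex: (eta x); case Ey: (eta y); rewrite /= ?eqxx ?Ex ?Ey.
case: eqVneq => [zy|zy].
  move: zx; rewrite zy => yx.
  by case Ex: (eta x); case Ey: (eta y); rewrite /= ?eqxx ?(negbTE yx) ?Ex ?Ey.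
by case: ifP => // _; rewrite (negbTE zx) (negbTE zy).
Qed.

Lemma measurable_site3 (phi : bool -> bool -> bool -> bool) x y z :
  measurable [set eta : conf d | phi (eta x) (eta y) (eta z)].
Proof.
rewrite (_ : [set _ | _] = \bigcup_(b in [set b : bool * bool * bool | phi b.1.1 b.1.2 b.2])
    ([set eta | eta x = b.1.1] `&` [set eta | eta y = b.1.2] `&` [set eta | eta z = b.2])).
  apply: fin_bigcup_measurable; first exact: finite_finset.
  by move=> b _; do 2?apply: measurableI; exact: measurable_site.
apply/seteqP; split=> [eta /= h|eta [[[b1 b2] b3] /= h [[e1 e2] e3]]];
  last by rewrite e1 e2 e3.
by exists (eta x, eta y, eta z).
Qed.

Lemma measurable_attempt x y : measurable_fun setT (attempt x y : conf d -> conf d).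
Proof.
apply: measurable_fun_conf => z.
pose phi a b c := if z == x then a && b else if z == y then a || b else c.
have := measurable_site3 phi x y z; congr measurable.
by apply/seteqP; split=> eta /=; rewrite attemptE.
Qed.

Definition site_agree x eta xi := eta x = xi x.

Lemma site_agree_attempt x y z eta : z != x -> z != y -> site_agree z (attempt x y eta) eta.
Proof. by move=> /negbTE zx /negbTE zy; rewrite /site_agree attemptE zx zy. Qed.

Lemma attempt_site_agree x y z eta xi : site_agree x eta xi -> site_agree y eta xi ->
  site_agree z eta xi -> site_agree z (attempt x y eta) (attempt x y xi).
Proof. by rewrite /site_agree !attemptE => -> -> ->. Qed.

Definition attempt2 x y (z : conf d * conf d) : conf d * conf d :=
  (attempt x y z.1, attempt x y z.2).

Lemma measurable_attempt2 x y : measurable_fun setT (attempt2 x y).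
Proof.
apply/measurable_fun_pairP; split.
  exact: (measurableT_comp (measurable_attempt x y) measurable_fst).
exact: (measurableT_comp (measurable_attempt x y) measurable_snd).
Qed.

Definition site_agree2 x (u v : conf d * conf d) := u.1 x = v.1 x /\ u.2 x = v.2 x.

Lemma site_agree2_attempt x y z u : z != x -> z != y -> site_agree2 z (attempt2 x y u) u.
Proof. by move=> zx zy; split; exact: site_agree_attempt. Qed.

Lemma attempt_site_agree2 x y z u v : site_agree2 x u v -> site_agree2 y u v ->
  site_agree2 z u v -> site_agree2 z (attempt2 x y u) (attempt2 x y v).
Proof. by move=> [x1 x2] [y1 y2] [z1 z2]; split; exact: attempt_site_agree. Qed.

Definition translate i eta : conf d := fun x => eta (x + i).

Definition translate2 i (z : conf d * conf d) := (translate i z.1, translate i z.2).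

Lemma measurable_translate i : measurable_fun setT (translate i).
Proof. by apply: measurable_fun_conf => x; exact: (measurable_site _ true). Qed.

Lemma measurable_translate2 i : measurable_fun setT (translate2 i).
Proof.
apply/measurable_fun_pairP; split.
  exact: (measurableT_comp (measurable_translate i) measurable_fst).
exact: (measurableT_comp (measurable_translate i) measurable_snd).
Qed.

Lemma translate_attempt i x y eta :
  translate i (attempt x y eta) = attempt (x - i) (y - i) (translate i eta).
Proof.
by apply/funext => z;
  rewrite attemptE /translate attemptE !subrK -!(inj_eq (addIr (- i)) (z + i)) !addrK.
Qed.

Lemma translate2_attempt i x y u :
  translate2 i (attempt2 x y u) = attempt2 (x - i) (y - i) (translate2 i u).
Proof. by rewrite /translate2 /attempt2 /= !translate_attempt. Qed.

Definition discrepancy k : set (conf d * conf d) := [set z | z.1 k != z.2 k].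

Lemma measurable_discrepancy k : measurable (discrepancy k).
Proof.
have -> : discrepancy k = ([set eta | eta k = true] `*` [set eta | eta k = false]) `|`
    ([set eta | eta k = false] `*` [set eta | eta k = true]).
  apply/seteqP; split=> [[eta xi]|[eta xi]]; rewrite /discrepancy /setX/=.
    by case: (eta k); case: (xi k) => //= _; [left|right].
  by move=> [] [-> ->].
by apply: measurableU; apply: measurableX; exact: measurable_site.
Qed.

Implicit Types w : conf d * conf d.

Lemma second_class_atP k w : second_class_at k w <->
  forall x, (w.1 x != w.2 x) = (x == k).
Proof.
split=> h x; first by apply/idP/eqP => /h.
by rewrite h; split=> /eqP.
Qed.

(** Suppose the discrepancy sits at one end of the edge; the copies share the value at the other
    end. Each copy puts the conjunction of its two values at [x] and the disjunction at [y]. If the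
    shared value is 1, the disjunctions agree and the discrepancy ends at [x]; if it is 0, the
    conjunctions agree and it ends at [y]. *)
Lemma second_class_at_attempt2 x y k w : second_class_at k w ->
  exists2 k', second_class_at k' (attempt2 x y w) &
    [|| k' == k, (k == x) && (k' == y) | (k == y) && (k' == x)].
Proof.
move=> /second_class_atP wk.
have eqk v : v != k -> w.1 v = w.2 v by move=> uk; apply/eqP; rewrite -[_ == _]negbK wk.
have neqk : w.1 k = ~~ w.2 k by have := wk k; rewrite eqxx; case: (w.1 k); case: (w.2 k).
have [e|xy] := eqVneq x y.
  exists k; rewrite ?eqxx//; apply/second_class_atP => v /=;
    rewrite !attemptE e !andbb !orbb.
  by case: (eqVneq v y) => [->|_]; exact: wk.
have [kx|kx] := eqVneq k x.
  have yk : y != k by rewrite kx eq_sym.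
  exists (if w.2 y then x else y); last by case: ifP; rewrite ?eqxx ?kx ?orbT ?eqxx.
  apply/second_class_atP => v /=; rewrite !attemptE -kx (eqk _ yk) neqk.
  case: (eqVneq v k) => [->|uk]; first by case: (w.2 k); case: (w.2 y);
    rewrite ?eqxx // eq_sym (negbTE yk).
  case: (eqVneq v y) => [->|uy]; first by case: (w.2 k); case: (w.2 y);
    rewrite ?eqxx // (negbTE yk).
  by rewrite wk (negbTE uk); case: (w.2 y); rewrite ?(negbTE uk) ?(negbTE uy).
have [ky|ky] := eqVneq k y.
  have xk : x != k by rewrite eq_sym.
  exists (if w.2 x then x else y); last by case: ifP; rewrite ?eqxx ?ky ?orbT ?eqxx.
  apply/second_class_atP => v /=; rewrite !attemptE -ky (eqk _ xk) neqk.
  case: (eqVneq v x) => [->|ux]; first by case: (w.2 k); case: (w.2 x);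
    rewrite ?eqxx // (negbTE xk).
  case: (eqVneq v k) => [->|uk]; first by case: (w.2 k); case: (w.2 x);
    rewrite ?eqxx // eq_sym (negbTE xk).
  by rewrite wk (negbTE uk); case: (w.2 x); rewrite ?(negbTE uk) ?(negbTE ux).
exists k; rewrite ?eqxx//; apply/second_class_atP => v /=; rewrite !attemptE.
rewrite (eqk x) 1?eq_sym// (eqk y) 1?eq_sym//.
case: (eqVneq v x) => [->|_]; first by rewrite eqxx eq_sym (negbTE kx).
case: (eqVneq v y) => [->|_]; first by rewrite eqxx eq_sym (negbTE ky).
exact: wk.
Qed.

(** Equal pairs are included so that the complement is a countable union of two-site events, which
    the generator can handle. That the copies do not become equal is obtained separately, in
    [second_class_conservation]. *)
Definition le1_discrepancy : set (conf d * conf d) :=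
  [set w | w.1 = w.2 \/ exists k, second_class_at k w].

Lemma attempt2_le1_discrepancy x y w : le1_discrepancy w ->
  le1_discrepancy (attempt2 x y w).
Proof.
case=> [e|[k wk]]; first by left; rewrite /attempt2/= e.
by right; have [k' ? _] := second_class_at_attempt2 x y wk; exists k'.
Qed.

Lemma not_le1_discrepancy w : ~ le1_discrepancy w ->
  exists x y, [/\ x != y, discrepancy x w & discrepancy y w].
Proof.
move=> nz; have [x wx] : exists x, discrepancy x w.
  apply: contrapT => /forallNP h; apply: nz; left; apply/funext => x.
  by apply/eqP; apply: contrapT => /negP; exact: h.
apply: contrapT => h; apply: nz; right; exists x => y; split=> [wy|->//].
by apply: contrapT => /eqP yx; apply: h; exists y, x.
Qed.

Lemma second_class_atE k : second_class_at k = discrepancy k `&` le1_discrepancy.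
Proof.
apply/seteqP; split=> w; first by move=> wk; split; [exact/wk|right; exists k].
case=> wk [e|[k' wk']]; first by move: wk; rewrite /discrepancy/= e eqxx.
by have /wk' -> := wk.
Qed.

Lemma measurable_second_class_at k : measurable (@second_class_at d k).
Proof.
have -> : @second_class_at d k = discrepancy k `&`
    \bigcap_(x in [set: site d]) (if x == k then setT else ~` discrepancy x).
  apply/seteqP; split=> [w wk|w [wk h] x].
    split; first exact/wk.
    by move=> x _; case: eqP => // xk; rewrite /discrepancy/= => /wk.
  split=> [wx|->//]; apply: contrapT => /eqP/negbTE xk.
  by have := h x I; rewrite xk; exact.
apply: measurableI; first exact: measurable_discrepancy.
rewrite -[X in measurable X]setCK setC_bigcap; apply: measurableC.
apply: countable_bigcupT_measurable => // x; apply: measurableC.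
by case: ifP => _ //; apply: measurableC; exact: measurable_discrepancy.
Qed.

End attempts.

(** * The coupling and the second class particle *)

Lemma measure_countable_bigcup0 (dT : measure_display) (T : measurableType dT)
    (R : realType) (mu : {measure set T -> \bar R}) (I : countType) (F : I -> set T) :
  (forall i, measurable (F i)) -> (forall i, mu (F i) = 0%E) -> mu (\bigcup_i F i) = 0%E.
Proof.
move=> mF F0; pose G n := if (choice.unpickle n : option I) is Some i then F i else set0.
have -> : \bigcup_i F i = \bigcup_n G n.
  apply/seteqP; split=> x [i _ Fx]; first by exists (choice.pickle i);
    rewrite // /G choice.pickleK.
  by move: Fx; rewrite /G; case: choice.unpickle => // j Fj; exists j.
apply/negligibleP; last first.
  apply: negligible_bigcup => n; rewrite /G; case: choice.unpickle => [i|];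
    last exact: negligible_set0.
  by apply/negligibleP; [exact: mF|exact: F0].
by apply: bigcupT_measurable => n; rewrite /G; case: choice.unpickle => [i|].
Qed.

Section indicator.
Context (dX : measure_display) (X : measurableType dX) (R : realType).
Implicit Types U : set X.

Lemma bounded_measurable_indic U : measurable U ->
  bounded_measurable (1 : R) (\1_U : X -> R).
Proof.
move=> mU; split; first exact: measurable_indic.
by move=> x; rewrite indicE; case: (_ \in _); rewrite ?normr1 ?normr0.
Qed.

Lemma semigroup_indic (P : R -> R.-pker X ~> X) t U x : measurable U ->
  (semigroup P t \1_U x)%:E = P t x U.
Proof.
move=> mU; have P1 : P t x setT = 1%E by exact: prob_kernel.
by rewrite (mean_EFin P1 (bounded_measurable_indic mU)) integral_indic ?setIT.
Qed.

End indicator.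

(** * Marginals, translation covariance and discrepancies of the basic coupling *)

Section exclusion.
Variables (d : nat) (R : realType) (p : site d -> site d -> R).
Hypothesis hp : nn_kernel p.
Variable P : R -> R.-pker (conf d) ~> (conf d).
Hypothesis hP : exclusion_process p P.
Variable Q : R -> R.-pker (conf d * conf d) ~> (conf d * conf d)%type.
Hypothesis hQ : basic_coupling p Q.
Implicit Types (A : {fset site d}) (x y k i : site d) (z : conf d * conf d).

Let P0 (u : conf d) U : measurable U -> P 0 u U = \d_u U.
Proof. by case: hP => -[h _ _ _ _]; exact: h. Qed.

Let PD (s t : R) (u : conf d) U : 0 <= s -> 0 <= t -> measurable U ->
  P (s + t) u U = (\int[P s u]_v P t v U)%E.
Proof. by case: hP => -[_ h _ _ _]; exact: h. Qed.

Let Q0 (u : conf d * conf d) U : measurable U -> Q 0 u U = \d_u U.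
Proof. by case: hQ => -[h _ _ _ _]; exact: h. Qed.

Let QD (s t : R) (u : conf d * conf d) U : 0 <= s -> 0 <= t -> measurable U ->
  Q (s + t) u U = (\int[Q s u]_v Q t v U)%E.
Proof. by case: hQ => -[_ h _ _ _]; exact: h. Qed.

Local Notation dep := (depends_on (@site_agree d)).
Local Notation dep2 := (depends_on (@site_agree2 d)).

Lemma exclusion_genE (f : conf d -> R) : exclusion_gen p f = jump_gen p (@attempt d) f.
Proof.
apply/funext => eta; apply: eq_fsbigr => -[x y] _ /=.
rewrite /attempt; case: (eta x); case: (eta y) => //=;
  by rewrite ?subrr ?subr0 ?mulr0 ?mulr1 ?mul0r.
Qed.

Let Pgen A (f : conf d -> R) : dep A f -> generates P f (jump_gen p (@attempt d) f).
Proof.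
move=> fA; rewrite -exclusion_genE; apply: (hP.2).
exists [set` A]; first exact: finite_fset.
by move=> eta xi h; apply: fA => x; exact: h.
Qed.

Let Qgen A (F : conf d * conf d -> R) : dep2 A F ->
  generates Q F (jump_gen p (@attempt2 d) F).
Proof.
move=> FA; apply: (hQ.2).
exists [set` A]; first exact: finite_fset.
by move=> z w h; apply: FA => x; exact: h.
Qed.

(** Both sides are measures in [U], so the events [ones A] suffice; their indicators depend on
    finitely many sites, and [pi] intertwines the attempted jumps. *)
Let marginal (pi : conf d * conf d -> conf d) (t : R) z U :
  measurable_fun setT pi -> (forall x z w, site_agree2 x z w ->
    site_agree x (pi z) (pi w)) ->
  (forall x y z, pi (attempt2 x y z) = attempt x y (pi z)) ->
  0 <= t -> measurable U -> Q t z (pi @^-1` U) = P t (pi z) U.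
Proof.
move=> mpi piA piT t0 mU.
have mpiU V : measurable V -> measurable (pi @^-1` V).
  by move=> mV; rewrite -[X in measurable X]setTI; exact: mpi.
suff : forall V, measurable V -> pushforward (Q t z) pi V = P t (pi z) V by exact.
move=> V mV; apply: (@measure_conf_unique d R (pushforward (Q t z) pi)) => //.
  have Q1 : Q t z setT = 1%E by exact: prob_kernel.
  by apply: (@le_lt_trans _ _ (Q t z setT)); [exact: lexx|rewrite Q1 ltry].
move=> A; have mA := @measurable_ones d A.
suff : Q t z (pi @^-1` ones A) = P t (pi z) (ones A) by exact.
rewrite -(semigroup_indic P t (pi z) mA) -(semigroup_indic Q t z (mpiU _ mA)).
congr EFin.
have -> : (\1_(pi @^-1` ones A) : _ -> R) = \1_(ones A) \o pi by [].
apply: (semigroup_comp hp (@measurable_attempt d) (@site_agree_attempt d)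
  (@attempt_site_agree d) P0 PD Pgen mpi Q0 QD _ (A := A) (B := 1)) => //.
- move=> B f fB.
  have -> : jump_gen p (@attempt d) f \o pi = jump_gen p (@attempt2 d) (f \o pi).
    by apply/funext => w; apply: eq_fsbigr => -[x y] _ /=; rewrite piT.
  apply: (@Qgen B) => w w' h; apply: fB => x xB; apply: piA; exact: h.
- move=> eta xi h; rewrite !indicE; congr (_ %:R); congr (nat_of_bool _).
  by apply/idP/idP; rewrite !inE => hA x xA; move: (hA x xA) (h x xA);
    rewrite /site_agree => -> // <-.
- by apply: bounded_measurable_indic; exact: measurable_ones.
Qed.

Lemma marginal_fst (t : R) z U : 0 <= t -> measurable U ->
  Q t z (fst @^-1` U) = P t z.1 U.
Proof. by apply: marginal => // x w w' []. Qed.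

Lemma marginal_snd (t : R) z U : 0 <= t -> measurable U ->
  Q t z (snd @^-1` U) = P t z.2 U.
Proof. by apply: marginal => // x w w' []. Qed.

(** Formulated for [discrepancy], an event of a single site, because [second_class_at] involves all
    sites; [coupling_discrepancy] identifies their probabilities. *)
Lemma coupling_translate i k (t : R) z : 0 <= t ->
  Q t z (discrepancy (k + i)) = Q t (translate2 i z) (discrepancy k).
Proof.
move=> t0; rewrite -!semigroup_indic; try exact: measurable_discrepancy.
congr EFin.
have -> : (\1_(discrepancy (k + i)) : _ -> R) = \1_(discrepancy k) \o translate2 i by [].
apply: (semigroup_comp hp (@measurable_attempt2 d) (@site_agree2_attempt d)
  (@attempt_site_agree2 d) Q0 QD Qgen (@measurable_translate2 d i) Q0 QD _
  (A := [fset k]%fset) (B := 1)) => //.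
- move=> B F FB.
  have -> : jump_gen p (@attempt2 d) F \o translate2 i =
      jump_gen p (@attempt2 d) (F \o translate2 i).
    apply/funext => w; rewrite /jump_gen /=.
    rewrite (reindex_fsbigT (fun e : site d * site d => (e.1 - i, e.2 - i))).
      apply: eq_fsbigr => -[x y] _ /=.
      rewrite translate2_attempt; congr (_ * _).
      by rewrite (kernelE hp) [in RHS](kernelE hp) opprB addrA subrK.
    exists (fun e => (e.1 + i, e.2 + i)) => -[x y] /=; by rewrite ?subrK ?addrK.
  pose B' : {fset site d} := [fset (x + i)%R | x in B]%fset.
  apply: (Qgen (A := B')) => w w' h; apply: FB => x xB.
  by apply: h; apply/imfsetP; exists x.
- move=> w w' h; rewrite !indicE; congr (_ %:R); congr (nat_of_bool _).
  have [e1 e2] : site_agree2 k w w' by apply: h; rewrite inE.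
  by apply/idP/idP; rewrite !inE /discrepancy/= e1 e2.
- by apply: bounded_measurable_indic; exact: measurable_discrepancy.
Qed.

Let coupling_eq0 A B (F : conf d * conf d -> R) (t : R) z :
  dep2 A F -> bounded_measurable B F -> (forall w, le1_discrepancy w -> F w = 0) ->
  le1_discrepancy z -> 0 <= t -> semigroup Q t F z = 0.
Proof.
exact: (semigroup_eq0 hp (@measurable_attempt2 d) (@site_agree2_attempt d)
  (@attempt_site_agree2 d) Q0 QD Qgen (@attempt2_le1_discrepancy d)).
Qed.

Lemma dep2_discrepancy x : dep2 [fset x]%fset (\1_(discrepancy x) : _ -> R).
Proof.
move=> w w' h; rewrite !indicE; congr (_ %:R); congr (nat_of_bool _).
have [e1 e2] : site_agree2 x w w' by apply: h; rewrite inE.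
by apply/idP/idP; rewrite !inE /discrepancy/= e1 e2.
Qed.

(** The diagonal gets the empty set, so that the family is indexed by a whole countable type. *)
Definition discrepancy_pair (e : site d * site d) : set (conf d * conf d) :=
  if e.1 == e.2 then set0 else discrepancy e.1 `&` discrepancy e.2.

Lemma measurable_discrepancy_pair e : measurable (discrepancy_pair e).
Proof.
rewrite /discrepancy_pair; case: ifP => // _.
by apply: measurableI; exact: measurable_discrepancy.
Qed.

Lemma discrepancy_pair_le1 e w : le1_discrepancy w -> ~ discrepancy_pair e w.
Proof.
move: e => [x y] w1; rewrite /discrepancy_pair /=; case: eqVneq => [_ []|xy [wx wy]].
case: w1 => [e|[k wk]]; first by move: wx; rewrite /discrepancy/= e eqxx.
by move: xy; rewrite ((wk x).1 wx) ((wk y).1 wy) eqxx.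
Qed.

Lemma setC_le1_discrepancy : ~` @le1_discrepancy d = \bigcup_e discrepancy_pair e.
Proof.
apply/seteqP; split=> w; last by move=> [e _ we] w1; exact: discrepancy_pair_le1 we.
move=> /not_le1_discrepancy[x [y [/negbTE xy wx wy]]].
by exists (x, y) => //; rewrite /discrepancy_pair xy.
Qed.

Lemma measurable_le1_discrepancy : measurable (@le1_discrepancy d).
Proof.
rewrite -[X in measurable X]setCK setC_le1_discrepancy; apply: measurableC.
by apply: countable_bigcupT_measurable => // e; exact: measurable_discrepancy_pair.
Qed.

Lemma coupling_le1_discrepancy (t : R) z : le1_discrepancy z -> 0 <= t ->
  Q t z (~` @le1_discrepancy d) = 0%E.
Proof.
move=> z1 t0; rewrite setC_le1_discrepancy.
apply: measure_countable_bigcup0 => [|[x y]]; first exact: measurable_discrepancy_pair.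
have mxy := @measurable_discrepancy_pair (x, y).
rewrite -semigroup_indic//; congr EFin.
apply: (@coupling_eq0 [fset x; y]%fset 1) => //.
- move=> w w' h; rewrite /discrepancy_pair /=; case: eqVneq => xy; first by rewrite !indic0.
  by rewrite !indicI /=; congr (_ * _); apply: dep2_discrepancy => u;
    rewrite inE => /eqP ->;
    apply: h; rewrite !inE eqxx ?orbT.
- exact: bounded_measurable_indic.
- move=> w w1; rewrite indicE memNset//; exact: discrepancy_pair_le1.
Qed.

(** Almost surely there is at most one discrepancy, so a discrepancy at [k] is the only one. *)
Lemma coupling_discrepancy k (t : R) z : le1_discrepancy z -> 0 <= t ->
  Q t z (discrepancy k) = Q t z (second_class_at k).
Proof.
move=> z1 t0; have mD := @measurable_discrepancy d k.
have mL := measurable_le1_discrepancy.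
rewrite second_class_atE [LHS](measureDI (Q t z) mD mL); rewrite -[RHS]add0e;
  congr (_ + _)%E.
apply/eqP; rewrite -measure_le0 -(coupling_le1_discrepancy z1 t0) le_measure ?inE//.
- by apply: measurableD.
- by apply: measurableC.
Qed.

(** Balls of the graph whose edges are the possible jumps, taken in both directions. *)
Fixpoint ball_fset k (n : nat) : {fset site d} :=
  if n is n'.+1 then
    (ball_fset k n' `|` [fset e.1 | e in edges p (ball_fset k n')]
                    `|` [fset e.2 | e in edges p (ball_fset k n')])%fset
  else [fset k]%fset.

Lemma ball_fset_step k n x y : p x y != 0 ->
  (x \in ball_fset k n -> y \in ball_fset k n.+1) /\
  (y \in ball_fset k n -> x \in ball_fset k n.+1).
Proof.
move=> pxy; split=> xB.
  have e : (x, y) \in edges p (ball_fset k n) by apply: in_edges => //; rewrite xB.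
  by rewrite !inE; apply/orP; right; apply/imfsetP; exists (x, y).
have e : (x, y) \in edges p (ball_fset k n) by apply: in_edges => //; rewrite xB orbT.
by rewrite !inE -orbA; apply/orP; right; apply/orP; left; apply/imfsetP; exists (x, y).
Qed.

Lemma ball_fset_le k m n x : (m <= n)%N -> x \in ball_fset k m -> x \in ball_fset k n.
Proof.
move=> /subnK <-; elim: (n - m)%N => // j ih xB.
by rewrite addSn !inE ih.
Qed.

(* [n] minus the graph distance to [k], truncated at [0]. *)
Definition height k n x : R := \sum_(j < n) (x \in ball_fset k j)%:R.

Lemma height_le k n x : height k n x <= n%:R.
Proof.
rewrite -[leRHS]mulr1 mulr_natl -[X in _ *+ X](card_ord n) -sumr_const.
by apply: ler_sum => j _; rewrite lern1 leq_b1.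
Qed.

Lemma height_center k n : height k n k = n%:R.
Proof.
rewrite /height (eq_bigr (fun=> 1)) ?sumr_const ?card_ord// => j _.
by rewrite (@ball_fset_le k 0)//= inE.
Qed.

Lemma height_out k n x : x \notin ball_fset k n -> height k n x = 0.
Proof.
move=> xB; rewrite /height big1// => j _.
by rewrite (negbTE (contra (ball_fset_le _) xB))//; exact: ltnW.
Qed.

Lemma height_step k n x y : p x y != 0 -> `|height k n x - height k n y| <= 1.
Proof.
move=> pxy.
have step u v : (forall j, u \in ball_fset k j -> v \in ball_fset k j.+1) ->
    height k n u <= height k n v + 1.
  move=> uv; apply: (@le_trans _ _ (\sum_(j < n) (v \in ball_fset k j.+1)%:R)).
    by apply: ler_sum => j _; rewrite ler_nat;
      have [/uv ->|//] := boolP (u \in ball_fset k j).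
  apply: (@le_trans _ _ (\sum_(j < n.+1) (v \in ball_fset k j)%:R)).
    by rewrite big_ord_recl lerDr.
  by rewrite big_ord_recr lerD2l lern1 leq_b1.
have xy := step x y (fun j => (ball_fset_step k j pxy).1).
have yx := step y x (fun j => (ball_fset_step k j pxy).2).
by rewrite ler_norml; lra.
Qed.

(** Summing over all discrepancies gives a function of finitely many sites, since heights vanish off
    the ball. With a single discrepancy it is the height of that discrepancy. *)
Definition discrepancy_height k n (z : conf d * conf d) : R :=
  \sum_(x <- ball_fset k n) height k n x * \1_(discrepancy x) z.

Lemma discrepancy_height_eq k n z : z.1 = z.2 -> discrepancy_height k n z = 0.
Proof.
move=> e; rewrite /discrepancy_height big1// => x _.
by rewrite indicE memNset ?mulr0// /discrepancy/= e eqxx.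
Qed.

Lemma discrepancy_height_second_class k n x z :
  second_class_at x z -> discrepancy_height k n z = height k n x.
Proof.
move=> /second_class_atP zx.
rewrite /discrepancy_height (eq_bigr (fun y => if y == x then height k n x else 0));
  last first.
  move=> y _; rewrite indicE.
  have -> : (z \in discrepancy y) = (z.1 y != z.2 y) by apply/idP/idP; rewrite inE.
  by rewrite zx; case: eqVneq => [->|_]; rewrite ?mulr1 ?mulr0.
rewrite -big_mkcond/=; have [xB|xB] := boolP (x \in ball_fset k n).
  by rewrite -big_filter (filter_pred1_uniq (fset_uniq _) xB) big_cons big_nil addr0.
by rewrite (height_out xB) big1.
Qed.

Lemma dep2_discrepancy_height k n : dep2 (ball_fset k n) (discrepancy_height k n).
Proof.
move=> w w' h; rewrite /discrepancy_height big_seq [RHS]big_seq.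
apply: eq_bigr => x xB; congr (_ * _); apply: dep2_discrepancy => y.
by rewrite inE => /eqP ->; exact: h.
Qed.

Lemma bounded_discrepancy_height k n : exists B,
  bounded_measurable B (discrepancy_height k n).
Proof.
eexists; apply: bounded_measurable_sum => x.
by apply: bounded_measurable_indic; exact: measurable_discrepancy.
Qed.

(** Only edges touching the discrepancy contribute: their total rate is at most 2, and a jump
    changes the height by at most 1. The bound does not depend on [n]. *)
Lemma jump_discrepancy_height k n z : le1_discrepancy z ->
  `|jump_gen p (@attempt2 d) (discrepancy_height k n) z| <= 2.
Proof.
case=> [e|[x zx]].
  rewrite /jump_gen fsbig1 ?normr0// => -[x y] _ /=.
  rewrite (discrepancy_height_eq _ _ e) discrepancy_height_eq ?subr0 ?mulr0//.
  by rewrite /attempt2/= e.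
rewrite /jump_gen (fsbigTE (edges p [fset x]%fset)); last first.
  move=> [u v] /= uvx; have [->|puv] := eqVneq (p u v) 0; first by rewrite mul0r.
  have [x' zx' /or3P[/eqP xx'|/andP[/eqP xu _]|/andP[/eqP xv _]]] :=
      second_class_at_attempt2 u v zx.
  - by rewrite (discrepancy_height_second_class _ _ zx)
      (discrepancy_height_second_class _ _ zx') xx' subrr mulr0.
  - by move: uvx; rewrite in_edges// inE xu eqxx.
  - by move: uvx; rewrite in_edges// !inE xv eqxx orbT.
apply: (le_trans (ler_norm_sum _ _ _)).
apply: (@le_trans _ _ (\sum_(e <- edges p [fset x]%fset) p e.1 e.2)); last first.
  by apply: (le_trans (sum_edges hp _)); rewrite cardfs1 mulr1.
apply: ler_sum => -[u v] _ /=; rewrite normrM ger0_norm ?kernel_ge0//.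
have [->|puv] := eqVneq (p u v) 0; first by rewrite mul0r.
rewrite ler_piMr ?kernel_ge0//.
have [x' zx' h] := second_class_at_attempt2 u v zx.
rewrite (discrepancy_height_second_class _ _ zx) (discrepancy_height_second_class _ _ zx').
case/or3P: h => [/eqP ->|/andP[/eqP -> /eqP ->]|/andP[/eqP -> /eqP ->]].
- by rewrite subrr normr0.
- by rewrite distrC; exact: height_step.
- exact: height_step.
Qed.

(** The generator bound holds only for pairs with at most one discrepancy. Truncation to [[-2, 2]]
    changes nothing on that set, so the difference [g - g'] vanishes there and has mean 0 at all
    times. *)
Let semigroup_jump_height k n (s : R) z : le1_discrepancy z -> 0 <= s ->
  `|semigroup Q s (jump_gen p (@attempt2 d) (discrepancy_height k n)) z| <= 2.
Proof.
move=> z1 s0; set g := jump_gen _ _ _.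
have [B bh] := bounded_discrepancy_height k n.
have hdep := @dep2_discrepancy_height k n.
have [A gA] := depends_on_jump_gen hp (@site_agree2_attempt d)
  (@attempt_site_agree2 d) hdep.
have [C bg] := bounded_measurable_jump_gen hp (@measurable_attempt2 d)
  (@site_agree2_attempt d) hdep bh.
pose g' w := Num.max (-2) (Num.min 2 (g w)).
have bg' : bounded_measurable 2 g'.
  split; first by apply: measurable_maxr => //; apply: measurable_minr => //; exact: bg.1.
  by move=> w; rewrite /g' ler_norml le_max lexx /= ge_max ge_min lexx /=; lra.
have Q1 : Q s z setT = 1%E by exact: prob_kernel.
have : semigroup Q s (g \- g') z = 0.
  apply: (coupling_eq0 (A := A) _ (bounded_measurableB bg bg')) => //.
    by move=> w w' h; have e : g w = g w' := gA w w' h; rewrite /= /g' e; congr (_ - _).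
  move=> w w1 /=; have := jump_discrepancy_height k n w1;
    rewrite -/g ler_norml => /andP[l r].
  have e : g' w = g w by rewrite /g' (min_idPr r) (max_idPr l).
  by rewrite e; exact: subrr.
rewrite /semigroup (meanB Q1 bg bg') => /subr0_eq ->.
exact: (le_norm_mean Q1 bg').
Qed.

Let semigroup_height_ge k n (t : R) z : le1_discrepancy z -> 0 <= t ->
  discrepancy_height k n z - 2 * t <= semigroup Q t (discrepancy_height k n) z.
Proof.
move=> z1 t0; set h := discrepancy_height k n.
have [B bh] := bounded_discrepancy_height k n.
have hdep := @dep2_discrepancy_height k n.
pose S s := semigroup Q s h z.
rewrite lerBlDr -lerBlDl -[X in X - _](_ : S 0 = _);
  last by rewrite /S (semigroup0 Q0 bh.1).
have -> : S 0 - semigroup Q t h z = - S t - - S 0 by rewrite opprK addrC.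
rewrite -[t in 2 * t]subr0 -[t - 0]expr1.
apply: (@le_power_of_derive _ (fun s => - S s)
  (fun s => - semigroup Q s (jump_gen p (@attempt2 d) h) z)) => //.
- move=> s; apply: cvgN.
  exact: (jump_semigroup_continuous hp (@measurable_attempt2 d)
    (@site_agree2_attempt d) (@attempt_site_agree2 d)
    (@measurable_id _ (conf d * conf d)%type setT) Q0 QD Qgen hdep bh).
- move=> s; rewrite in_itv/= => /andP[s0 _]; apply: is_deriveN.
  exact: (is_derive_semigroup_jump_gen hp (@measurable_attempt2 d)
    (@site_agree2_attempt d) (@attempt_site_agree2 d)
    (@measurable_id _ (conf d * conf d)%type setT) QD Qgen z hdep bh s0).
- move=> s; rewrite in_itv/= => /andP[s0 _]; rewrite expr0 !mulr1.
  by rewrite (le_trans (ler_norm _))// normrN semigroup_jump_height// ltW.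
Qed.

(* The discrepancy does not escape to infinity: its height started from [n]
   decreases at rate at most [2], while the height of an escaped discrepancy is
   [0]. *)
Lemma second_class_conservation k (t : R) z : second_class_at k z -> 0 <= t ->
  Q t z (\bigcup_x @second_class_at d x) = 1%E.
Proof.
move=> zk t0; set E := \bigcup_x _.
have z1 : le1_discrepancy z by right; exists k.
have mE : measurable E.
  by apply: countable_bigcupT_measurable => // x; exact: measurable_second_class_at.
have mL := measurable_le1_discrepancy.
have Q1 : Q t z setT = 1%E by exact: prob_kernel.
pose q := semigroup Q t \1_E z.
rewrite -(semigroup_indic Q t z mE) -/q; congr EFin; apply/eqP; rewrite eq_le.
have bE := bounded_measurable_indic R mE.
have mLc : measurable (~` @le1_discrepancy d) by exact: measurableC.
have bL := bounded_measurable_indic R mLc.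
rewrite (le_trans (ler_norm _) (semigroup_bound _ _ _ bE))/=.
have hn n : n%:R - 2 * t <= n%:R * q.
  have [B bh] := bounded_discrepancy_height k n.
  have := semigroup_height_ge k n z1 t0.
  rewrite (discrepancy_height_second_class _ _ zk) height_center => /le_trans; apply.
  have B0 := bounded_measurable_ge0 bh.
  (* With two or more discrepancies only the bound [B], which depends on [n], is at hand; it
     multiplies the indicator of a null event. *)
  have hle w : discrepancy_height k n w <= n%:R * \1_E w + B * \1_(~` @le1_discrepancy d) w.
    have [[e|[x wx]]|w1] := pselect (le1_discrepancy w).
    - by rewrite discrepancy_height_eq// addr_ge0// mulr_ge0.
    - rewrite (discrepancy_height_second_class _ _ wx) !indicE [w \in E]mem_set;
        last by exists x.
      by rewrite mulr1 (le_trans (height_le _ _ _))// lerDl mulr_ge0.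
    - rewrite !indicE [w \in ~` _]mem_set// mulr1 (le_trans (ler_norm _))//.
      by rewrite (le_trans (bh.2 w))// lerDr mulr_ge0.
  have -> : n%:R * q = \int[Q t z]_w (n%:R * \1_E w + B * \1_(~` @le1_discrepancy d) w).
    have iE := bounded_measurable_integrable Q1 (bounded_measurableZ n%:R bE).
    have iL := bounded_measurable_integrable Q1 (bounded_measurableZ B bL).
    rewrite (RintegralD measurableT iE iL).
    rewrite (RintegralZl _ measurableT (bounded_measurable_integrable Q1 bE)).
    rewrite (RintegralZl _ measurableT (bounded_measurable_integrable Q1 bL)).
    have -> : \int[Q t z]_w \1_(~` @le1_discrepancy d) w = 0 :> R.
      have := semigroup_indic Q t z mLc.
      by rewrite coupling_le1_discrepancy// => -[].
    by rewrite mulr0 addr0.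
  apply: le_Rintegral => //; first exact: (bounded_measurable_integrable Q1 bh).
  have bS := bounded_measurableB (bounded_measurableZ n%:R bE) (bounded_measurableZ
    (- B) bL).
  have := bounded_measurable_integrable Q1 bS; congr (integrable _ _ _).
  by apply/funext => w /=; rewrite mulNr opprK.
rewrite leNgt; apply/negP => q1.
(* If [q < 1], the inequality [n (1 - q) <= 2 t] fails as soon as [n > 2 t / (1 - q)]. *)
have := hn (Num.trunc (2 * t / (1 - q))).+1.
set m := _.+1 => hm.
have : 2 * t / (1 - q) < m%:R by exact: truncnS_gt.
rewrite ltr_pdivrMr ?subr_gt0// mulrBr mulr1; lra.
Qed.

End exclusion.

(** * The Efron-Stein inequality *)

Section density.
Variables (d : nat) (R : realType) (nu : probability (conf d) R).
Local Notation dep := (depends_on (@site_agree d)).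
Implicit Types (f g h : conf d -> R).

Let nu1 : nu setT = 1%E. Proof. exact: probability_setT. Qed.

(** Distance in the mean suffices, since in the products of [efron_stein] the other factor is
    bounded. *)
Definition approximable g := forall e : R, 0 < e -> exists A B h,
  [/\ dep A h, bounded_measurable B h & \int[nu]_x `|g x - h x| <= e].

Lemma approximable_dep A B g : dep A g -> bounded_measurable B g -> approximable g.
Proof.
move=> gA bg e e0; exists A, B, g; split=> //.
rewrite (_ : \int[nu]_x `|g x - g x| = 0) ?ltW//.
rewrite -[RHS](mean_cst nu1 0); apply: eq_Rintegral => x _.
by rewrite subrr normr0.
Qed.

Lemma approximable_lim B g : bounded_measurable B g ->
  (forall e : R, 0 < e -> exists C g', [/\ bounded_measurable C g', approximable g' &
     \int[nu]_x `|g x - g' x| <= e]) -> approximable g.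
Proof.
move=> bg lim e e0; have e20 : 0 < e / 2 by rewrite divr_gt0.
have [C [g' [bg' ag' gg']]] := lim _ e20.
have [A [D [h [hA bh g'h]]]] := ag' _ e20.
exists A, D, h; split=> //; rewrite (le_trans (mean_dist_triangle nu1 bg bg' bh))//.
by rewrite [leRHS]splitr lerD.
Qed.

Lemma approximableD B C f g : bounded_measurable B f -> bounded_measurable C g ->
  approximable f -> approximable g -> approximable (f \+ g).
Proof.
move=> bf bg af ag e e0; have e20 : 0 < e / 2 by rewrite divr_gt0.
have [A [D [h [hA bh fh]]]] := af _ e20.
have [A' [D' [h' [hA' bh' gh']]]] := ag _ e20.
exists (A `|` A')%fset, (D + D'), (h \+ h'); split.
- by move=> u v uv; congr (_ + _); [apply: hA|apply: hA'] => x xA; apply: uv;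
    rewrite inE xA ?orbT.
- exact: bounded_measurableD.
- apply: (@le_trans _ _ (\int[nu]_x `|f x - h x| + \int[nu]_x `|g x - h' x|)); last first.
    by rewrite [leRHS]splitr lerD.
  have b1 := bounded_measurable_dist bf bh.
  have b2 := bounded_measurable_dist bg bh'.
  rewrite -(meanD nu1 b1 b2); apply: (le_mean nu1 _ (bounded_measurableD b1 b2)).
    exact: (bounded_measurable_dist (bounded_measurableD bf bg)
      (bounded_measurableD bh bh')).
  by move=> x /=; rewrite opprD addrACA ler_normD.
Qed.

Lemma approximableZ B g r : bounded_measurable B g ->
  approximable g -> approximable (fun x => r * g x).
Proof.
move=> bg ag e e0; have r0 : 0 < `|r| + 1 by rewrite ltr_wpDl.
have /ag[A [D [h [hA bh gh]]]] : 0 < e / (`|r| + 1) by rewrite divr_gt0.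
exists A, (`|r| * D), (fun x => r * h x); split.
- by move=> u v uv; rewrite (hA _ _ uv).
- exact: bounded_measurableZ.
- have -> : \int[nu]_x `|r * g x - r * h x| = `|r| * \int[nu]_x `|g x - h x|.
    rewrite -(meanZ nu1 _ (bounded_measurable_dist bg bh)).
    by apply: eq_Rintegral => x _; rewrite -mulrBr normrM.
  apply: (@le_trans _ _ (`|r| * (e / (`|r| + 1)))); first by rewrite ler_wpM2l.
  rewrite mulrCA; apply: ler_piMr; first exact: ltW.
  by rewrite ler_pdivrMr// mul1r lerDl.
Qed.

(** The sets with approximable indicator form a lambda-system containing the pi-system [ones];
    increasing unions use continuity of [nu] from below. *)
Lemma approximable_indic (U : set (conf d)) : measurable U -> approximable \1_U.
Proof.
move: U; pose G : set (set (conf d)) := [set U | measurable U /\ approximable \1_U].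
have b1 (U : set (conf d)) : measurable U -> bounded_measurable (1 : R) (\1_U : _ ->
  R) by exact: bounded_measurable_indic.
suff : @measurable _ (conf d) `<=` G by move=> h U /h[].
rewrite measurable_confE; apply: lambda_system_subset => //.
- by move=> _ _ [A _ <-] [B _ <-]; exists (A `|` B)%fset => //; rewrite ones_setI.
- split => //.
  + split => //; apply: (@approximable_dep fset0 1); last exact: b1.
    by move=> u v _; rewrite !indicT.
  + move=> U V VU [mU aU] [mV aV]; split; first exact: measurableD.
    have -> : \1_(U `\` V) = \1_U \+ (fun x => -1 * \1_V x) :> (conf d -> R).
      apply/funext => x; rewrite /= !indicE in_setD mulN1r.
      have [xV|xV] := boolP (x \in V); last by rewrite andbT subr0.
      by rewrite [x \in U]mem_set ?subrr//; apply: VU; exact: set_mem.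
    have aV' := approximableZ (-1) (b1 _ mV) aV.
    exact: (approximableD (b1 _ mU) (bounded_measurableZ (-1) (b1 _ mV)) aU aV').
  + move=> F ndF GF.
    have mF n : measurable (F n) by case: (GF n).
    have mU : measurable (\bigcup_n F n) by exact: bigcupT_measurable.
    split=> //; apply: (approximable_lim (b1 _ mU)) => e e0.
    have cvF : nu (F n) @[n --> \oo] --> nu (\bigcup_n F n) by exact: nondecreasing_cvg_mu.
    have [n hn] : exists n, (nu (\bigcup_n F n) - e%:E <= nu (F n))%E.
      apply: contrapT => /forallNP nh.
      have : (limn (nu \o F) <= nu (\bigcup_n F n) - e%:E)%E.
        apply: lime_le; first by apply/cvg_ex; eexists; exact: cvF.
        by apply: nearW => n; have /negP := nh n; rewrite -ltNge => /ltW.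
      rewrite (cvg_lim _ cvF)//.
      have : nu (\bigcup_n F n) \is a fin_num by exact: fin_num_measure.
      case: (nu _) => // r _; rewrite -EFinB lee_fin; lra.
    exists 1, \1_(F n); split; [exact: b1|by case: (GF n)|].
    have sub : F n `<=` \bigcup_n F n by move=> x Fx; exists n.
    have -> : \int[nu]_x `|\1_(\bigcup_n F n) x - \1_(F n) x| =
        \int[nu]_x \1_(\bigcup_n F n) x - \int[nu]_x \1_(F n) x.
      rewrite -(meanB nu1 (b1 _ mU) (b1 _ (mF n))); apply: eq_Rintegral => x _.
      rewrite ger0_norm// subr_ge0 !indicE ler_nat.
      by have [xF|//] := boolP (x \in F n); rewrite [x \in bigcup _ _]mem_set//;
        apply: sub; exact: set_mem.
    rewrite lerBlDr -lerBlDl -lee_fin EFinB.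
    rewrite (mean_EFin nu1 (b1 _ mU)) (mean_EFin nu1 (b1 _ (mF n))).
    by rewrite !integral_indic// !setIT.
- move=> _ [A _ <-]; split; first exact: measurable_ones.
  apply: (@approximable_dep A 1); last by apply: b1; exact: measurable_ones.
  move=> u v uv; rewrite !indicE; congr (_ %:R); congr (nat_of_bool _).
  by apply/idP/idP; rewrite !inE => hA x xA; have := hA x xA; rewrite (uv x xA).
Qed.

Lemma approximable_sum (I : Type) (s : seq I) (w : I -> R) (U : I -> set (conf d)) :
  (forall i, measurable (U i)) -> approximable (fun x => \sum_(i <- s) w i * \1_(U i) x).
Proof.
move=> mU; elim: s => [|i s ih].
  apply: (@approximable_dep fset0 0); first by move=> u v _; rewrite !big_nil.
  split; first by under eq_fun do rewrite big_nil; exact: measurable_cst.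
  by move=> x; rewrite big_nil normr0.
have bU j : bounded_measurable (1 : R) (\1_(U j) : _ ->
  R) by exact: bounded_measurable_indic.
have := approximableD (bounded_measurableZ (w i) (bU i)) (bounded_measurable_sum s w bU)
  (approximableZ (w i) (bU i) (approximable_indic (mU i))) ih.
by congr approximable; apply/funext => x; rewrite big_cons.
Qed.

Import HBSimple.

Lemma approximable_bounded_measurable B g : bounded_measurable B g -> approximable g.
Proof.
move=> bg; apply: (approximable_lim bg) => e e0.
have [g_ [_ _ cvg_g]] := approximation_sfun_integrable measurableT
  (bounded_measurable_integrable nu1 bg).
have [n hn] : exists n, (\int[nu]_x `|(g x)%:E - (g_ n x)%:E| <= e%:E)%E.
  apply: contrapT => /forallNP nh.
  have : (e%:E <= limn (fun n => \int[nu]_x `|(g x)%:E - (g_ n x)%:E|))%E.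
    apply: lime_ge; first by apply/cvg_ex; eexists; exact: cvg_g.
    by apply: nearW => n; have /negP := nh n; rewrite -ltNge => /ltW.
  by rewrite (cvg_lim _ cvg_g)// lee_fin leNgt e0.
pose s := fset_set (range (g_ n)).
have mU y : measurable (g_ n @^-1` [set y]) by exact: measurable_sfunP.
have gE : (g_ n : _ -> R) = fun x => \sum_(y <- s) y * \1_(g_ n @^-1` [set y]) x.
  by apply/funext => x; rewrite fimfunE (fsbig_finite _ _ (fimfunP _)).
have bg_ := bounded_measurable_sum s id (fun y => bounded_measurable_indic R (mU y)).
rewrite -gE in bg_; eexists; exists (g_ n); split; first exact: bg_.
  by rewrite gE; exact: approximable_sum.
by rewrite -lee_fin (mean_EFin nu1 (bounded_measurable_dist bg bg_)).
Qed.

End density.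

(** * Bernoulli measures and pairs of independent copies *)

Section bernoulli.
Variables (d : nat) (R : realType) (rho : R) (nu : probability (conf d) R).
Hypothesis hnu : bernoulli_product rho nu.
Implicit Types (A B : {fset site d}) (i x : site d) (z : conf d * conf d).

Let nu1 : nu setT = 1%E. Proof. exact: probability_setT. Qed.

Lemma bernoulli_ones A : nu (ones A) = (rho ^+ #|` A|)%:E.
Proof.
have -> : ones A = [set eta | forall x, x \in A -> eta x = true] by [].
rewrite hnu big_const_seq count_predT; congr EFin.
by elim: (size _) => //= n ->; rewrite exprS.
Qed.

Lemma bernoulli_translate i (U : set (conf d)) : measurable U ->
  nu (translate i @^-1` U) = nu U.
Proof.
move=> mU; suff : forall V, measurable V -> pushforward nu (translate i) V = nu V by exact.
have ms := @measurable_translate d i.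
move=> V mV; apply: (@measure_conf_unique d R (pushforward nu (translate i))) => //.
  by apply: (@le_lt_trans _ _ (nu setT)); [exact: lexx|rewrite nu1 ltry].
move=> A; pose B : {fset site d} := [fset (x + i)%R | x in A]%fset.
have e : translate i @^-1` ones A = ones B.
  apply/seteqP; split=> eta h x; last by move=> xA; apply: h; apply/imfsetP; exists x.
  by move=> /imfsetP[y /= yA ->]; exact: h.
suff : nu (translate i @^-1` ones A) = nu (ones A) by exact.
by rewrite e !bernoulli_ones card_imfset//; exact: addIr.
Qed.

Lemma measure_pair_unique (m1 m2 : {measure set (conf d * conf d) -> \bar R}) :
  (m1 setT < +oo)%E ->
  (forall A B, m1 (ones A `*` ones B) = m2 (ones A `*` ones B)) ->
  forall U, measurable U -> m1 U = m2 U.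
Proof.
move=> m1oo m12 U mU.
pose G : set (set (conf d * conf d)) := range (fun AB => ones AB.1 `*` ones AB.2).
have onesT : ones fset0 = [set: conf d] by apply/seteqP; split.
have GE : @measurable _ (conf d * conf d)%type = <<s G >>.
  rewrite measurable_prod_measurableType; apply/seteqP; split; apply: smallest_sub;
    try exact: smallest_sigma_algebra.
    have mfst : measurable_fun setT (fst : g_sigma_algebraType G -> conf d).
      apply: measurable_fun_conf => x; apply: sub_sigma_algebra.
      exists ([fset x]%fset, fset0) => //=; apply/seteqP; split=> u /=; rewrite onesT.
        by move=> [h _]; apply: h; rewrite inE.
      by move=> ux; split=> // y; rewrite inE => /eqP ->.
    have msnd : measurable_fun setT (snd : g_sigma_algebraType G -> conf d).
      apply: measurable_fun_conf => x; apply: sub_sigma_algebra.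
      exists (fset0, [fset x]%fset) => //=; apply/seteqP; split=> u /=; rewrite onesT.
        by move=> [_ h]; apply: h; rewrite inE.
      by move=> ux; split=> // y; rewrite inE => /eqP ->.
    move=> _ [V mV [W mW <-]].
    have -> : V `*` W = (setT `&` fst @^-1` V) `&` (setT `&` snd @^-1` W).
      by rewrite !setTI.
    apply: (@measurableI _ (g_sigma_algebraType G)); first exact: mfst.
    exact: msnd.
  move=> _ [[A B] _ <-]; apply: sub_sigma_algebra.
  exists (ones A); first exact: measurable_ones.
  by exists (ones B) => //; exact: measurable_ones.
apply: (measure_unique G (fun=> setT)) => //.
- move=> _ _ [[A B] _ <-] [[A' B'] _ <-].
  by exists ((A `|` A')%fset, (B `|` B')%fset) => //=; rewrite -!ones_setI setXI.
- by move=> _; exists (fset0, fset0) => //=; rewrite onesT setXTT.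
- by apply/seteqP; split=> // eta _; exists 0%N.
- by move=> _ [[A B] _ <-]; exact: m12.
Qed.

Local Notation M := (nu \x nu)%E.

Lemma pair_measure1 : M setT = 1%E.
Proof.
rewrite -setXTT product_measure1E//.
by apply: (@eq_trans _ _ (nu setT * nu setT)%E) => //; rewrite nu1 mule1.
Qed.

Lemma mean_pair (B C : R) (g h : conf d -> R) : bounded_measurable B g ->
  bounded_measurable C h ->
  \int[M]_z (g z.1 * h z.2) = \int[nu]_x g x * \int[nu]_x h x.
Proof.
move=> bg bh.
have bgf : bounded_measurable B (g \o fst : conf d * conf d -> R).
  by split=> [|z]; [apply: measurableT_comp => //; exact: bg.1|exact: bg.2].
have bhs : bounded_measurable C (h \o snd : conf d * conf d -> R).
  by split=> [|z]; [apply: measurableT_comp => //; exact: bh.1|exact: bh.2].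
have iM := bounded_measurable_integrable pair_measure1 (bounded_measurableM bgf bhs).
apply: EFin_inj.
rewrite (mean_EFin pair_measure1 (bounded_measurableM bgf bhs)) -(integral12_prod_meas1 iM).
rewrite mulrC -(meanZ nu1 _ bg) (mean_EFin nu1 (bounded_measurableZ _ bg)).
apply: eq_integral => x _; rewrite /fubini_F /=.
rewrite -(mean_EFin nu1 (bounded_measurableZ (g x) bh)); congr EFin.
by rewrite (meanZ nu1 _ bh) mulrC.
Qed.

Definition swap i z : conf d * conf d :=
  ((fun x => if x == i then z.2 x else z.1 x),
   (fun x => if x == i then z.1 x else z.2 x)).

Lemma measurable_swap i : measurable_fun setT (swap i).
Proof.
have m1 x : measurable [set z : conf d * conf d | z.1 x].
  by rewrite -[X in measurable X]setTI;
    exact: (measurable_fst measurableT _ (measurable_site x true)).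
have m2 x : measurable [set z : conf d * conf d | z.2 x].
  by rewrite -[X in measurable X]setTI;
    exact: (measurable_snd measurableT _ (measurable_site x true)).
by apply/measurable_fun_pairP; split; apply: measurable_fun_conf => x /=; case: eqP.
Qed.

Lemma swapK i : involutive (swap i).
Proof.
by move=> [eta xi]; congr (_, _); apply/funext => x /=; case: eqP.
Qed.

Lemma swapC i j z : swap i (swap j z) = swap j (swap i z).
Proof. by congr (_, _); apply/funext => x /=; case: eqP; case: eqP. Qed.

Let swap_fset i A B := ((A `\ i) `|` (if i \in B then [fset i] else fset0))%fset.

Let card_swap_fset i A B :
  (#|` swap_fset i A B| = #|` (A `\ i)%fset| + (i \in B))%N.
Proof.
rewrite /swap_fset; case: ifP => _; last by rewrite fsetU0 addn0.
by rewrite fsetUC cardfsU1 !inE eqxx addnC.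
Qed.

(** On the generating rectangles, exchanging site [i] moves a constraint from one copy to the other.
    The number [#|A| + #|B|] of occupied sites required is unchanged, and the mass of the rectangle
    is [rho] to that power. *)
Lemma pair_measure_swap i U : measurable U -> M (swap i @^-1` U) = M U.
Proof.
move=> mU; suff : forall V, measurable V -> pushforward M (swap i) V = M V by exact.
have ms := @measurable_swap i.
move=> V mV; apply: (@measure_pair_unique (pushforward M (swap i))) => //.
  by apply: (@le_lt_trans _ _ (M setT)); [exact: lexx|rewrite pair_measure1 ltry].
move=> A B.
have e : swap i @^-1` (ones A `*` ones B) =
  ones (swap_fset i A B) `*` ones (swap_fset i B A).
  have in_swap x A' B' : x \in swap_fset i A' B' = if x == i then i \in B' else x \in A'.
    rewrite /swap_fset in_fsetU in_fsetD1.
    have -> : (x \in (if i \in B' then [fset i] else fset0)%fset) = (x == i) && (i \in B').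
      by case: ifP => _; rewrite inE ?andbT ?andbF.
    by case: (x == i) => //=; rewrite orbF.
  apply/seteqP; split=> -[eta xi] /= [hA hB]; split=> x; rewrite ?in_swap.
  - case: eqP => [-> /hB|xi' /hA] /=; first by rewrite eqxx.
    by rewrite (introF eqP xi').
  - case: eqP => [-> /hA|xi' /hB] /=; first by rewrite eqxx.
    by rewrite (introF eqP xi').
  - move=> xA; have := hA x; have := hB x; rewrite !in_swap.
    by case: eqP => [e h _|_ _ h]; apply: h => //; rewrite -e.
  - move=> xA; have := hA x; have := hB x; rewrite !in_swap.
    by case: eqP => [e _ h|_ h _]; apply: h => //; rewrite -e.
suff : M (swap i @^-1` (ones A `*` ones B)) = M (ones A `*` ones B) by exact.
have ME A1 A2 : M (ones A1 `*` ones A2) = (rho ^+ (#|` A1| + #|` A2|))%:E.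
  apply: (@eq_trans _ _ (nu (ones A1) * nu (ones A2))%E).
    by apply: product_measure1E; exact: measurable_ones.
  by rewrite !bernoulli_ones -EFinM -exprD.
rewrite e !ME !card_swap_fset; congr EFin; congr (_ ^+ _).
rewrite (cardfsD1 i A) (cardfsD1 i B) !(addnC (nat_of_bool _)).
by rewrite addnACA [RHS]addnACA; congr addn; exact: addnC.
Qed.

End bernoulli.

(** * Exchanging sites one at a time *)

Section efron_stein.
Variables (d : nat) (R : realType) (rho : R) (nu : probability (conf d) R).
Hypothesis hnu : bernoulli_product rho nu.
Implicit Types (A : {fset site d}) (i x : site d) (s : seq (site d)).
Implicit Types (z : conf d * conf d).

Local Notation M := (nu \x nu)%E.

Let nu1 : nu setT = 1%E. Proof. exact: probability_setT. Qed.
Let M1 : M setT = 1%E. Proof. exact: pair_measure1. Qed.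

Lemma mean_swap i (B : R) (F : conf d * conf d -> R) : bounded_measurable B F ->
  \int[M]_z F (swap i z) = \int[M]_z F z.
Proof.
move=> bF; have ms := @measurable_swap d i.
have bFs := bounded_measurable_comp ms bF.
have iF := bounded_measurable_integrable M1 bFs.
have mF : measurable_fun setT (EFin \o F) by apply/measurable_EFinP; exact: bF.1.
rewrite /Rintegral; congr fine.
have := integral_pushforward ms mF iF measurableT.
rewrite preimage_setT => <-.
by apply: eq_measure_integral => V mV _; exact: (pair_measure_swap hnu i mV).
Qed.

Fixpoint swaps s z := if s is i :: s' then swap i (swaps s' z) else z.

Lemma measurable_swaps s : measurable_fun setT (swaps s).
Proof.
elim: s => [|i s ih]; first exact: measurable_id.
exact: (measurableT_comp (@measurable_swap d i) ih).
Qed.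

Lemma mean_swaps s (B : R) (F : conf d * conf d -> R) : bounded_measurable B F ->
  \int[M]_z F (swaps s z) = \int[M]_z F z.
Proof.
elim: s F => // i s ih F bF /=.
by rewrite (ih (F \o swap i) (bounded_measurable_comp (@measurable_swap d i) bF))
  (mean_swap i bF).
Qed.

Lemma swaps_swap s i z : swaps s (swap i z) = swap i (swaps s z).
Proof. by elim: s => //= j s ->; rewrite swapC. Qed.

Lemma swapsE s z : uniq s ->
  swaps s z = ((fun x => if x \in s then z.2 x else z.1 x),
               (fun x => if x \in s then z.1 x else z.2 x)).
Proof.
elim: s => [_|i s ih /= /andP[is_ us]]; first by case: z.
rewrite (ih us); congr (_, _); apply/funext => x /=; rewrite inE;
  by case: eqP => [->|]//=; rewrite (negbTE is_).
Qed.

Definition set_at i (eta : conf d) a : conf d := fun x => if x == i then a else eta x.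

Lemma set_at_id i eta : set_at i eta (eta i) = eta.
Proof. by apply/funext => x; rewrite /set_at; case: eqP => // ->. Qed.

Lemma measurable_set_at i a : measurable_fun setT (set_at i ^~ a).
Proof.
apply: measurable_fun_conf => x; rewrite /set_at; case: eqP => _;
  last exact: (measurable_site x true).
by case: a; [rewrite (_ : [set _ | _] = setT)//|rewrite (_ : [set _ | _] = set0)//];
  apply/seteqP; split.
Qed.

Variables (B : R) (g : conf d -> R).
Hypothesis bg : bounded_measurable B g.

Definition site_gradient i eta : R := g (set_at i eta true) - g (set_at i eta false).

Lemma bounded_site_gradient i : bounded_measurable (B + B) (site_gradient i).
Proof.
exact: (bounded_measurableB (bounded_measurable_comp (@measurable_set_at i true) bg)
  (bounded_measurable_comp (@measurable_set_at i false) bg)).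
Qed.

Let bfst (C : R) (h : conf d -> R) : bounded_measurable C h ->
  bounded_measurable C (fun z : conf d * conf d => h z.1).
Proof. by move=> bh; exact: (bounded_measurable_comp measurable_fst bh). Qed.

Let mean_fst (C : R) (h : conf d -> R) : bounded_measurable C h ->
  \int[M]_z h z.1 = \int[nu]_x h x.
Proof.
move=> bh; have b1 : bounded_measurable 1 (fun _ : conf d => 1 : R).
  by split=> [|x]; [exact: measurable_cst|rewrite normr1].
rewrite -[RHS]mulr1 -[X in _ * X](mean_cst nu1 1) -(mean_pair _ bh b1).
by apply: eq_Rintegral => z _; rewrite mulr1.
Qed.

Let D i z := g z.1 - g (swap i z).1.

Let bD i : bounded_measurable (B + B) (D i).
Proof.
exact: (bounded_measurableB (bfst bg)
  (bounded_measurable_comp (@measurable_swap d i) (bfst bg))).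
Qed.

Let D_swap i z : D i (swap i z) = - D i z.
Proof. by rewrite /D swapK opprB. Qed.

(** Exchanging site [i] replaces [z.1 i] by [z.2 i], so [D i z] is 0 or, up to sign, the gradient at
    [z.1]. The probability that the two values differ is simply bounded by 1. *)
Let mean_D2 i : \int[M]_z (D i z ^+ 2) <= \int[nu]_x (site_gradient i x ^+ 2).
Proof.
have bG2 := bounded_measurableM (bounded_site_gradient i) (bounded_site_gradient i).
rewrite -(mean_fst bG2); apply: (le_mean M1 (bounded_measurableM (bD i) (bD i)) (bfst bG2)).
move=> z /=; rewrite -!expr2 /D /site_gradient.
have -> : (swap i z).1 = set_at i z.1 (z.2 i).
  by apply/funext => x; rewrite /swap /set_at /=; case: eqP => // ->.
rewrite -[X in g X - _](set_at_id i z.1).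
case: (z.1 i); case: (z.2 i); rewrite ?subrr ?expr0n ?sqr_ge0//=.
by rewrite -[leLHS]sqrrN opprB.
Qed.

Let a s := \int[M]_z (g z.1 * g (swaps s z).1).

(** The increment is the mean of [g z.1 * D i (swaps s z)]. As [D i] is odd and the measure
    invariant under [swap i], twice the increment is the mean of [D i z * D i (swaps s z)]; then
    [2 x y <= x^2 + y^2] and invariance under [swaps s] conclude. *)
Let a_step i s : a s - a (i :: s) <= \int[M]_z (D i z ^+ 2).
Proof.
have bs s' : bounded_measurable B (fun z => g (swaps s' z).1).
  exact: (bounded_measurable_comp (@measurable_swaps s') (bfst bg)).
have bDs : bounded_measurable (B + B) (fun z => D i (swaps s z)).
  exact: (bounded_measurable_comp (@measurable_swaps s) (bD i)).
have bgD := bounded_measurableM (bfst bg) bDs.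
have bsg : bounded_measurable B (fun z => g (swap i z).1).
  exact: (bounded_measurable_comp (@measurable_swap d i) (bfst bg)).
have bsgD := bounded_measurableM bsg bDs.
have aE : a s - a (i :: s) = \int[M]_z (g z.1 * D i (swaps s z)).
  rewrite -(meanB M1 (bounded_measurableM (bfst bg) (bs s))
    (bounded_measurableM (bfst bg) (bs (i :: s)))).
  by apply: eq_Rintegral => z _; rewrite -mulrBr.
have aE' : a s - a (i :: s) = - \int[M]_z (g (swap i z).1 * D i (swaps s z)).
  rewrite aE -(mean_swap i bgD) -mulN1r -(meanZ M1 _ bsgD).
  by apply: eq_Rintegral => z _; rewrite /= swaps_swap D_swap mulrN mulN1r.
have bDD := bounded_measurableM (bD i) bDs.
have aE2 : (a s - a (i :: s)) * 2 = \int[M]_z (D i z * D i (swaps s z)).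
  rewrite mulr_natr mulr2n {1}aE aE' -(meanB M1 bgD bsgD).
  by apply: eq_Rintegral => z _; rewrite -mulrBl.
have bD2 := bounded_measurableM (bD i) (bD i).
have bD2s := bounded_measurableM bDs bDs.
have : (a s - a (i :: s)) * 2 <= \int[M]_z (D i z ^+ 2).
  rewrite aE2.
  have -> : \int[M]_z (D i z ^+ 2) = 2^-1 * (\int[M]_z (D i z * D i z) +
      \int[M]_z (D i (swaps s z) * D i (swaps s z))).
    have -> : \int[M]_z (D i (swaps s z) * D i (swaps s z)) = \int[M]_z (D i z * D i z).
      exact: (mean_swaps s bD2).
    have -> : \int[M]_z (D i z ^+ 2) = \int[M]_z (D i z * D i z) by [].
    lra.
  rewrite -(meanD M1 bD2 bD2s) -(meanZ M1 _ (bounded_measurableD bD2 bD2s)).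
  apply: (le_mean M1 bDD (bounded_measurableZ _ (bounded_measurableD bD2 bD2s))) => z /=.
  have := sqr_ge0 (D i z - D i (swaps s z)); rewrite sqrrB !expr2; lra.
have : 0 <= \int[M]_z (D i z ^+ 2) by apply: Rintegral_ge0 => z _; exact: sqr_ge0.
lra.
Qed.

Let a_bound s : a [::] - a s <= \sum_(i <- s) \int[nu]_x (site_gradient i x ^+ 2).
Proof.
elim: s => [|i s ih]; first by rewrite subrr big_nil.
rewrite big_cons; have := le_trans (a_step i s) (mean_D2 i); lra.
Qed.

Let a_nil : a [::] = \int[nu]_x (g x ^+ 2).
Proof. exact: (mean_fst (bounded_measurableM bg bg)). Qed.

(* Resampling the sites of a large set [A] makes the two factors of [a A]
   nearly independent, since [g] is close to a function of the sites in [A]. *)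
Theorem efron_stein (e : R) : 0 < e -> exists A,
  \int[nu]_x (g x ^+ 2) - (\int[nu]_x g x) ^+ 2 <=
  \sum_(i <- A) \int[nu]_x (site_gradient i x ^+ 2) + e.
Proof.
move=> e0; have B0 := bounded_measurable_ge0 bg.
(* Replacing [g] by [h] and back costs [B * eps] each time; [B + 1] avoids a division by 0. *)
have e'0 : 0 < e / (2 * (B + 1)) by rewrite divr_gt0// mulr_gt0// ltr_wpDl.
have [A [C [h [hA bh gh]]]] := approximable_bounded_measurable nu bg e'0.
exists A; have := a_bound A; rewrite a_nil.
suff : a A <= (\int[nu]_x g x) ^+ 2 + e by lra.
set eps := e / _ in e'0 gh.
(* After the exchange, the first copy agrees on [A] with the second copy before it, which is
   independent of [z.1]. *)
have hs z : h (swaps A z).1 = h z.2.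
  by rewrite swapsE ?fset_uniq//; apply: hA => x xA; rewrite /site_agree /= xA.
have bgs : bounded_measurable B (fun z => g (swaps A z).1).
  exact: (bounded_measurable_comp (@measurable_swaps A) (bfst bg)).
have bhs : bounded_measurable C (fun z : conf d * conf d => h z.2).
  exact: (bounded_measurable_comp measurable_snd bh).
have b1 := bounded_measurableM (bfst bg) bgs.
have b2 := bounded_measurableM (bfst bg) bhs.
have bgh := bounded_measurable_dist bg bh.
have s1 : a A - \int[nu]_x g x * \int[nu]_x h x <= B * eps.
  rewrite -(mean_pair _ bg bh) (le_trans (ler_norm _))//.
  rewrite (le_trans (mean_dist_ge M1 b1 b2))//.
  have bdist : bounded_measurable (B + C) (fun z => `|g (swaps A z).1 - h (swaps A z).1|).
    exact: (bounded_measurable_comp (@measurable_swaps A) (bfst bgh)).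
  apply: (@le_trans _ _ (\int[M]_z (B * `|g (swaps A z).1 - h (swaps A z).1|))).
    apply: (le_mean M1 (bounded_measurable_dist b1 b2) (bounded_measurableZ B bdist)) =>
      z /=.
    by rewrite -mulrBr normrM hs ler_wpM2r//; exact: bg.2.
  rewrite (meanZ M1 _ bdist) ler_wpM2l//.
  by rewrite (mean_swaps A (bfst bgh)) (mean_fst bgh).
have s2 : \int[nu]_x g x * \int[nu]_x h x - (\int[nu]_x g x) ^+ 2 <= B * eps.
  rewrite expr2 -mulrBr (le_trans (ler_norm _))// normrM ler_pM//.
    exact: (le_norm_mean nu1 bg).
  by rewrite distrC (le_trans (mean_dist_ge nu1 bg bh)).
have : 2 * (B * eps) <= e.
  have -> : 2 * (B * eps) = e * (B / (B + 1)).
    rewrite /eps invfM; have : B + 1 != 0 by rewrite gt_eqF// ltr_wpDl.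
    by move=> ?; field.
  by rewrite ger_pMr// ler_pdivrMr ?ltr_wpDl// mul1r lerDl.
lra.
Qed.

End efron_stein.

(** * Unordered sums *)

Section esum.
Variable R : realType.
Local Open Scope ereal_scope.

(** An enumeration of the sites turns unordered sums into series, for which termwise integration and
    measurability are at hand. *)
Lemma esum_pickle (I : countType) (a : I -> \bar R) : (forall i, 0 <= a i) ->
  \esum_(i in [set: I]) a i =
  \sum_(n <oo) (if (choice.pickle_inv n : option I) is Some i then a i else 0).
Proof.
move=> a0; pose b n := if (choice.pickle_inv n : option I) is Some i then a i else 0.
rewrite -/(b _) nneseries_esumT; last by move=> n; rewrite /b; case: choice.pickle_inv.
rewrite -/b.
have -> : \esum_(n in [set: nat]) b n = \esum_(n in range (@choice.pickle I)) b n.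
  rewrite [RHS]esum_mkcond; apply: eq_esum => n _; case: ifPn => // nr.
  rewrite /b; case e: (choice.pickle_inv n : option I) => [i|]//.
  exfalso; apply/negP: nr; rewrite negbK; apply/mem_set; exists i => //.
  by have := @choice.pickle_invK I n; rewrite e.
rewrite esum_image; last by move=> i j _ _; exact: (pcan_inj (@choice.pickleK I)).
by apply: eq_esum => i _; rewrite /b choice.pickleK_inv.
Qed.

Lemma fset_sum_le_esum (I : choiceType) (a : I -> \bar R) (A : {fset I}) :
  \sum_(i <- A) a i <= \esum_(i in [set: I]) a i.
Proof.
apply: esum_ge; exists [set` A]; first by split=> //; exact: finite_fset.
by rewrite -fsbig_seq.
Qed.

Lemma esumZl_le (I : choiceType) (c : \bar R) (a : I -> \bar R) :
  0 <= c -> (forall i, 0 <= a i) ->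
  \esum_(i in [set: I]) (c * a i) <= c * \esum_(i in [set: I]) a i.
Proof.
move=> c0 a0; apply: ge_ereal_sup => _ [X [finX _] <-].
rewrite (fsbig_finite _ _ finX) -ge0_sume_distrr//.
by rewrite lee_wpmul2l// fset_sum_le_esum.
Qed.

Lemma integral_esum (dT : measure_display) (T : measurableType dT)
    (mu : {measure set T -> \bar R}) (I : countType) (F : I -> T -> \bar R) :
  (forall i, measurable_fun setT (F i)) -> (forall i x, 0 <= F i x) ->
  \int[mu]_x (\esum_(i in [set: I]) F i x) = \esum_(i in [set: I]) \int[mu]_x F i x.
Proof.
move=> mF F0; pose G n x := if (choice.pickle_inv n : option I) is Some i then F i x else 0.
under eq_integral do rewrite esum_pickle//.
rewrite (integral_nneseries mu measurableT (f := G)).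
- rewrite esum_pickle; last by move=> i; exact: integral_ge0.
  apply: eq_eseriesr => n _; rewrite /G; case: choice.pickle_inv => //.
  exact: integral0.
- by move=> n; rewrite /G; case: choice.pickle_inv.
- by move=> n x _; rewrite /G; case: choice.pickle_inv.
Qed.

Lemma measurable_esum (dT : measure_display) (T : measurableType dT)
    (I : countType) (F : I -> T -> \bar R) :
  (forall i, measurable_fun setT (F i)) -> (forall i x, 0 <= F i x) ->
  measurable_fun setT (fun x => \esum_(i in [set: I]) F i x).
Proof.
move=> mF F0; under eq_fun do rewrite esum_pickle//.
apply: ge0_emeasurable_sum => [n x _|n _]; first by case: choice.pickle_inv.
by case: choice.pickle_inv.
Qed.

(** The weighted sum of [(b i - c)^2] is a nonnegative quadratic in [c]; its minimum is at
    [c = S / A]. *)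
Lemma sum_cauchy_schwarz (I : eqType) (s : seq I) (a b : I -> R) :
  (forall i, (0 <= a i)%R) ->
  ((\sum_(i <- s) a i * b i) ^+ 2 <= (\sum_(i <- s) a i) * \sum_(i <- s) a i * b i ^+ 2)%R.
Proof.
move=> a0; set A := (\sum_(i <- s) a i)%R; set S := (\sum_(i <- s) _ * _)%R.
set T := (X in (_ <= _ * X)%R).
have A0 : (0 <= A)%R by exact: sumr_ge0.
have quad c : (0 <= T - 2 * c * S + c ^+ 2 * A)%R.
  have -> : (T - 2 * c * S + c ^+ 2 * A = \sum_(i <- s) a i * (b i - c) ^+ 2)%R.
    rewrite /T /S /A !mulr_sumr -sumrB -big_split; apply: eq_bigr => i _ /=.
    by rewrite sqrrB; ring.
  by apply: sumr_ge0 => i _; rewrite mulr_ge0 ?sqr_ge0.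
have [A_eq0|A_neq0] := eqVneq A 0%R.
  have -> : S = 0%R.
    rewrite /S big_seq big1// => i si.
    move/eqP: A_eq0; rewrite /A psumr_eq0// => /allP/(_ _ si)/= /eqP ->.
    by rewrite mul0r.
  by rewrite expr0n/= A_eq0 mul0r.
have A_gt0 : (0 < A)%R by rewrite lt_neqAle eq_sym A_neq0.
have := quad (S / A)%R.
have -> : (T - 2 * (S / A) * S + (S / A) ^+ 2 * A = (A * T - S ^+ 2) / A)%R by field.
by rewrite pmulr_lge0 ?invr_gt0// subr_ge0.
Qed.

Lemma esum_cauchy_schwarz (I : choiceType) (a b : I -> R) (x : R) :
  (forall i, (0 <= a i)%R) -> (forall i, (0 <= b i)%R) -> (0 <= x)%R ->
  x%:E <= \esum_(i in [set: I]) (a i * b i)%:E ->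
  (x ^+ 2)%:E <=
    (\esum_(i in [set: I]) (a i)%:E) * \esum_(i in [set: I]) (a i * b i ^+ 2)%:E.
Proof.
move=> a0 b0 x0 xle; set A := \esum_(i in _) (a i)%:E; set T := (X in _ <= _ * X).
have A0 : 0 <= A by apply: esum_ge0 => i _; rewrite lee_fin.
have T0 : 0 <= T by apply: esum_ge0 => i _; rewrite lee_fin mulr_ge0 ?sqr_ge0.
have AT0 : 0 <= A * T by exact: mule_ge0.
case E : (A * T) AT0 => [r| |]//; last by move=> _; exact: leey.
rewrite lee_fin => r0.
have : x%:E <= (Num.sqrt r)%:E.
  apply: (le_trans xle); apply: ge_ereal_sup => _ [X [finX _] <-].
  rewrite (fsbig_finite _ _ finX) sumEFin lee_fin.
  have S0 : (0 <= \sum_(i <- fset_set X) a i * b i)%R.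
    by apply: sumr_ge0 => i _; rewrite mulr_ge0.
  rewrite -(ger0_norm S0) -sqrtr_sqr ler_sqrt//.
  apply: (le_trans (sum_cauchy_schwarz _ _ a0)).
  rewrite -lee_fin -E EFinM -!sumEFin.
  by apply: lee_pmul; rewrite ?sumEFin ?lee_fin ?sumr_ge0// -?sumEFin ?fset_sum_le_esum//;
    move=> i _; rewrite mulr_ge0 ?sqr_ge0.
rewrite !lee_fin => xr; rewrite -(sqr_sqrtr r0).
by rewrite ler_pXn2r ?nnegrE// sqrtr_ge0.
Qed.

End esum.

(** * The variance bound *)

Section second_class.
Variables (d : nat) (R : realType) (p : site d -> site d -> R).
Hypothesis hp : nn_kernel p.
Variables (rho : R) (nu : probability (conf d) R).
Hypothesis hnu : bernoulli_product rho nu.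
Variable P : R -> R.-pker (conf d) ~> (conf d).
Hypothesis hP : exclusion_process p P.
Variable Q : R -> R.-pker (conf d * conf d) ~> (conf d * conf d)%type.
Hypothesis hQ : basic_coupling p Q.
Variables (t : R) (B : R) (f : conf d -> R).
Hypothesis t0 : 0 <= t.
Hypothesis bf : bounded_measurable B f.
Implicit Types (i k : site d) (eta : conf d).

Let nu1 : nu setT = 1%E. Proof. exact: probability_setT. Qed.

Definition discrepancy_at i eta : conf d * conf d :=
  (set_at i eta true, set_at i eta false).

Lemma second_class_discrepancy_at i eta : second_class_at i (discrepancy_at i eta).
Proof.
by apply/second_class_atP => x; rewrite /= /set_at; case: (eqVneq x i) => _; rewrite ?eqxx.
Qed.

Lemma measurable_discrepancy_at i : measurable_fun setT (discrepancy_at i).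
Proof.
by apply/measurable_fun_pairP; split; [exact: (@measurable_set_at d i true)
  | exact: (@measurable_set_at d i false)].
Qed.

Lemma translate_discrepancy_at i eta :
  translate2 i (discrepancy_at i eta) =
    (set_origin (translate i eta) true, set_origin (translate i eta) false).
Proof.
have e x : (x + i == i) = (x == 0) by rewrite -subr_eq0 addrK.
by congr (_, _); apply/funext => x; rewrite /= /translate /set_at /set_origin e.
Qed.

Let bsc k : bounded_measurable 1 (\1_(second_class_at k) : conf d * conf d -> R).
Proof. by apply: bounded_measurable_indic; exact: measurable_second_class_at. Qed.

(* [P(X_t = k)] for the second class particle started at [i]. *)
Definition second_class_prob i k eta : R :=
  semigroup Q t \1_(second_class_at k) (discrepancy_at i eta).

Lemma bounded_second_class_prob i k : bounded_measurable 1 (second_class_prob i k).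
Proof.
exact: (bounded_measurable_comp (measurable_discrepancy_at i)
  (bounded_measurable_semigroup Q t (bsc k))).
Qed.

Lemma second_class_prob_ge0 i k eta : 0 <= second_class_prob i k eta.
Proof. by apply: Rintegral_ge0 => z _; rewrite indicE. Qed.

Lemma second_class_probE i k eta :
  (second_class_prob i k eta)%:E = Q t (discrepancy_at i eta) (second_class_at k).
Proof. by rewrite (semigroup_indic Q t _ (@measurable_second_class_at d k)). Qed.

(** [Psi] is defined for a discrepancy at the origin only; this brings an arbitrary starting site
    there. *)
Lemma second_class_prob_translate i k eta :
  second_class_prob i k eta = second_class_prob 0 (k - i) (translate i eta).
Proof.
apply: EFin_inj; rewrite !second_class_probE.
have le1 j xi : le1_discrepancy (discrepancy_at j xi).
  by right; exists j; exact: second_class_discrepancy_at.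
rewrite -!(coupling_discrepancy hp hQ _ (le1 _ _) t0).
rewrite -[in LHS](subrK i k) (coupling_translate hp hQ i (k
  - i) _ t0) translate_discrepancy_at.
by congr (Q t _ _).
Qed.

Lemma Psi_sqr k : Psi nu Q t k ^+ 2 = \int[nu]_eta (second_class_prob 0 k eta ^+ 2).
Proof.
rewrite /Psi sqr_sqrtr; last by apply: Rintegral_ge0 => eta _; exact: sqr_ge0.
by apply: eq_Rintegral => eta _; congr (_ ^+ 2);
  rewrite -[RHS]/(fine _%:E) second_class_probE.
Qed.

Lemma second_class_prob_sqr i k :
  \int[nu]_eta (second_class_prob i k eta ^+ 2) = Psi nu Q t (k - i) ^+ 2.
Proof.
rewrite Psi_sqr; have ms := @measurable_translate d i.
pose F eta := second_class_prob 0 (k - i) eta ^+ 2.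
have bF : bounded_measurable (1 * 1) F.
  exact: (bounded_measurableM (bounded_second_class_prob 0 (k - i))
    (bounded_second_class_prob 0 (k - i))).
have -> : \int[nu]_eta (second_class_prob i k eta ^+ 2) = \int[nu]_eta F (translate i eta).
  by apply: eq_Rintegral => eta _; rewrite second_class_prob_translate.
have iF := bounded_measurable_integrable nu1 (bounded_measurable_comp ms bF).
have mF : measurable_fun setT (EFin \o F) by apply/measurable_EFinP; exact: bF.1.
rewrite /Rintegral; congr fine.
have := integral_pushforward ms mF iF measurableT.
rewrite preimage_setT => <-.
by apply: eq_measure_integral => V mV _; exact: (bernoulli_translate hnu i mV).
Qed.

Lemma flip_second_class k (z : conf d * conf d) : second_class_at k z -> z.1 = flip k z.2.
Proof.
move=> /second_class_atP zk; apply/funext => x; have := zk x; rewrite /flip.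
by case: (eqVneq x k) => _; case: (z.1 x); case: (z.2 x).
Qed.

Lemma flipK k : involutive (@flip d k).
Proof. by move=> eta; apply/funext => x; rewrite /flip; case: eqP => // ->;
  rewrite negbK. Qed.

(** As [f] is bounded, the real supremum in [delta] is a true upper bound and not a default
    value. *)
Let le_delta k eta : f (flip k eta) - f eta <= delta f k.
Proof.
apply: sup_upper_bound; last by exists eta.
split; first by exists (f (flip k eta) - f eta); exists eta.
exists (B + B) => _ [xi _ <-]; apply: (le_trans (ler_norm _)).
by rewrite (le_trans (ler_normB _ _))// lerD//; exact: bf.2.
Qed.

(** [delta] has no absolute value; the opposite sign is covered because [flip k] is an
    involution. *)
Let le_norm_delta k (z : conf d * conf d) : second_class_at k z ->
  `|f z.1 - f z.2| <= delta f k.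
Proof.
move=> /flip_second_class e; rewrite ler_norml lerNl opprB e le_delta andbT.
by rewrite -[X in f X - _](flipK k) le_delta.
Qed.

Lemma delta_ge0 k : 0 <= delta f k.
Proof.
exact: le_trans (le_norm_delta (second_class_discrepancy_at k (fun=> true))).
Qed.

Lemma semigroup_gradient_le i eta :
  (`|site_gradient (semigroup P t f) i eta|%:E <=
   \esum_(k in [set: site d]) (delta f k * second_class_prob i k eta)%:E)%E.
Proof.
set z := discrepancy_at i eta.
have Q1 : Q t z setT = 1%E by exact: prob_kernel.
have bf1 := bounded_measurable_comp (@measurable_fst _ _ (conf d) (conf d)) bf.
have bf2 := bounded_measurable_comp (@measurable_snd _ _ (conf d) (conf d)) bf.
have mf : measurable_fun setT (EFin \o f) by apply/measurable_EFinP; exact: bf.1.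
have e1 : semigroup P t f (set_at i eta true) = \int[Q t z]_w f w.1.
  rewrite /semigroup /Rintegral; congr fine.
  have := integral_pushforward measurable_fst mf
    (bounded_measurable_integrable Q1 bf1) measurableT.
  rewrite preimage_setT => <-.
  by apply: eq_measure_integral => V mV _; exact/esym/(marginal_fst hp hP hQ z t0 mV).
have e2 : semigroup P t f (set_at i eta false) = \int[Q t z]_w f w.2.
  rewrite /semigroup /Rintegral; congr fine.
  have := integral_pushforward measurable_snd mf
    (bounded_measurable_integrable Q1 bf2) measurableT.
  rewrite preimage_setT => <-.
  by apply: eq_measure_integral => V mV _; exact/esym/(marginal_snd hp hP hQ z t0 mV).
rewrite /site_gradient e1 e2.
have bdist := bounded_measurable_dist bf1 bf2.
apply: (@le_trans _ _ (\int[Q t z]_w `|f w.1 - f w.2|)%:E).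
  by rewrite lee_fin; exact: (mean_dist_ge Q1 bf1 bf2).
rewrite (mean_EFin Q1 bdist).
pose E : set (conf d * conf d) := \bigcup_k @second_class_at d k.
have mE : measurable E.
  by apply: countable_bigcupT_measurable => // x; exact: measurable_second_class_at.
have mEc : measurable (~` E) by exact: measurableC.
have QE : Q t z (~` E) = 0%E.
  have := second_class_conservation hp hQ (second_class_discrepancy_at i eta) t0.
  rewrite -/z -/E => QE; have Q1oo : (Q t z setT < +oo)%E by rewrite Q1 ltry.
  have : (Q t z (setT `\` E) = Q t z setT - Q t z (setT `&` E))%E by exact: measureD.
  by rewrite setTD setTI Q1 QE subee// => ->.
pose G k w : \bar R := (delta f k * \1_(second_class_at k) w)%:E.
have mG k : measurable_fun setT (G k).
  apply/measurable_EFinP; apply: measurable_funM => //.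
  exact: (bsc k).1.
have G0 k w : (0 <= G k w)%E by rewrite lee_fin mulr_ge0 ?delta_ge0// indicE.
(* [H] covers the null event that the copies do not differ at exactly one site, where no [delta f k]
   controls the difference. *)
pose H w : \bar R := ((B + B) * \1_(~` E) w)%:E.
have B0 := bounded_measurable_ge0 bf.
have bH := bounded_measurableZ (B + B) (bounded_measurable_indic R mEc).
have mH : measurable_fun setT H by apply/measurable_EFinP; exact: bH.1.
have H0 w : (0 <= H w)%E by rewrite lee_fin mulr_ge0 ?addr_ge0// indicE.
have mGs := measurable_esum mG G0.
have Gs0 w : (0 <= \esum_(k in [set: site d]) G k w)%E by exact: esum_ge0.
apply: (@le_trans _ _ (\int[Q t z]_w (\esum_(k in [set: site d]) G k w + H w))%E).
  apply: ge0_le_integral => //.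
  - by apply/measurable_EFinP; exact: bdist.1.
  - exact: emeasurable_funD.
  - move=> w _; have [[k _ wk]|wE] := pselect (E w).
      apply: (@le_trans _ _ (G k w)).
        by rewrite lee_fin indicE mem_set// mulr1 le_norm_delta.
      apply: (@le_trans _ _ (\esum_(k in [set: site d]) G k w)%E); last by rewrite leeDl.
      have := fset_sum_le_esum (fun k => G k w) [fset k]%fset.
      by rewrite big_seq_fset1.
    rewrite (@le_trans _ _ (H w))//; last by rewrite leeDr.
    rewrite lee_fin indicE mem_set// mulr1 (le_trans (ler_normB _ _))// lerD//; exact: bf.2.
rewrite ge0_integralD// integral_esum//.
have -> : (\int[Q t z]_w H w = 0)%E.
  rewrite -(mean_EFin Q1 bH) (meanZ Q1 _ (bounded_measurable_indic R mEc)) EFinM.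
  rewrite (mean_EFin Q1 (bounded_measurable_indic R mEc)) integral_indic// setIT.
  by rewrite [X in (_ * X)%E]QE mule0.
rewrite adde0; apply: le_esum => k _.
rewrite -(mean_EFin Q1 (bounded_measurableZ (delta f k) (bsc k))).
by rewrite (meanZ Q1 _ (bsc k)).
Qed.

(** One factor [D] comes from Cauchy-Schwarz, the other from the sum over final sites [k]. The
    estimate lives in the extended reals because [D] may be infinite. *)
Lemma sum_gradient_le (A : {fset site d}) :
  ((\sum_(i <- A) \int[nu]_eta (site_gradient (semigroup P t f) i eta ^+ 2))%:E <=
   (\esum_(k in [set: site d]) (Psi nu Q t k ^+ 2)%:E) *
   (\esum_(k in [set: site d]) (delta f k)%:E) ^+ 2)%E.
Proof.
set W := (\esum_(k in _) (Psi _ _ _ _ ^+ 2)%:E)%E.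
set D := (\esum_(k in _) (delta f k)%:E)%E.
have W0 : (0 <= W)%E by apply: esum_ge0 => k _; rewrite lee_fin sqr_ge0.
have D0 : (0 <= D)%E by apply: esum_ge0 => k _; rewrite lee_fin delta_ge0.
have bg := bounded_measurable_semigroup P t bf.
have term i : ((\int[nu]_eta (site_gradient (semigroup P t f) i eta ^+ 2))%:E <=
    D * \esum_(k in [set: site d]) (delta f k * Psi nu Q t (k - i) ^+ 2)%:E)%E.
  have bG := bounded_site_gradient bg i.
  have bG2 := bounded_measurableM bG bG.
  have -> : \int[nu]_eta (site_gradient (semigroup P t f) i eta ^+ 2) =
    \int[nu]_eta (site_gradient (semigroup P t f) i \* site_gradient
      (semigroup P t f) i) eta by [].
  rewrite (mean_EFin nu1 bG2).
  pose F k eta : \bar R := (delta f k * second_class_prob i k eta ^+ 2)%:E.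
  have bF k := bounded_measurableZ (delta f k) (bounded_measurableM
    (bounded_second_class_prob i k) (bounded_second_class_prob i k)).
  have mF k : measurable_fun setT (F k) by apply/measurable_EFinP; exact: (bF k).1.
  have F0 k eta : (0 <= F k eta)%E by rewrite lee_fin mulr_ge0 ?delta_ge0 ?sqr_ge0.
  have mFs := measurable_esum mF F0.
  apply: (@le_trans _ _ (\int[nu]_eta (D * \esum_(k in [set: site d]) F k eta))%E).
    apply: ge0_le_integral => //.
    - by move=> eta _; rewrite lee_fin /= -expr2 sqr_ge0.
    - by apply/measurable_EFinP; exact: bG2.1.
    - exact: measurable_funeM.
    - move=> eta _; rewrite /= -expr2 -real_normK ?num_real//.
      apply: esum_cauchy_schwarz => //; [exact: delta_ge0|by move=> k;
        exact: second_class_prob_ge0|].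
      exact: semigroup_gradient_le.
  rewrite ge0_integralZl//; last by move=> eta _; apply: esum_ge0.
  rewrite integral_esum//; apply: lee_wpmul2l => //; apply: le_esum => k _.
  by rewrite -(mean_EFin nu1 (bF k)) (meanZ nu1 _ (bounded_measurableM
    (bounded_second_class_prob i k) (bounded_second_class_prob i k)))
      -second_class_prob_sqr.
rewrite -sumEFin; apply: (@le_trans _ _ (\sum_(i <- A) (D *
    \esum_(k in [set: site d]) (delta f k * Psi nu Q t (k - i) ^+ 2)%:E))%E).
  by apply: lee_sum => i _; exact: term.
have a0 i k : (0 <= (delta f k * Psi nu Q t (k - i) ^+ 2)%:E)%E.
  by rewrite lee_fin mulr_ge0 ?delta_ge0 ?sqr_ge0.
rewrite -ge0_sume_distrr; last by move=> i _; exact: esum_ge0.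
rewrite expe2 muleCA; apply: lee_wpmul2l => //.
rewrite -esum_sum//.
apply: (@le_trans _ _ (\esum_(k in [set: site d]) (W * (delta f k)%:E))%E); last first.
  by apply: esumZl_le => // k; rewrite lee_fin delta_ge0.
apply: le_esum => k _.
under eq_bigr do rewrite EFinM.
rewrite -ge0_sume_distrr; last by move=> i _; rewrite lee_fin sqr_ge0.
rewrite muleC; apply: lee_wpmul2r; first by rewrite lee_fin delta_ge0.
(* For a fixed final site [k], the reflection [i -> k - i] is a bijection of the lattice, so the sum
   over starting sites in [A] is part of [W]. *)
have -> : W = (\esum_(i in [set: site d]) (Psi nu Q t (k - i) ^+ 2)%:E)%E.
  apply: (reindex_esum [set: site d] [set: site d] (fun i => k - i)).
  by split=> // [i j _ _ /addrI/oppr_inj//|i _]; exists (k - i);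
    rewrite // opprB addrC subrK.
exact: fset_sum_le_esum.
Qed.

End second_class.

Lemma variance_bounded (dT : measure_display) (T : measurableType dT) (R : realType)
    (mu : probability T R) (B : R) (g : T -> R) : bounded_measurable B g ->
  'V_mu[g]%E = (\int[mu]_x (g x ^+ 2) - (\int[mu]_x g x) ^+ 2)%:E.
Proof.
move=> bg; have mu1 : mu setT = 1%E by exact: probability_setT.
set m := \int[mu]_x g x.
have bm : bounded_measurable `|m| (fun _ : T => m) by split.
have bgm := bounded_measurableB bg bm.
have -> : 'V_mu[g]%E = (\int[mu]_x (((g \- cst m) \* (g \- cst m)) x)%:E)%E.
  by rewrite /variance covariance.unlock expectation.unlock.
rewrite -(mean_EFin mu1 (bounded_measurableM bgm bgm)); congr EFin.
have b2 := bounded_measurableM bg bg.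
have bl := bounded_measurableZ (2 * m) bg.
have b1 : bounded_measurable (m ^+ 2) (fun _ : T => m ^+ 2).
  by split=> // x; rewrite ger0_norm// sqr_ge0.
transitivity (\int[mu]_x (((g \* g) x - 2 * m * g x) + m ^+ 2)).
  by apply: eq_Rintegral => x _ /=; ring.
rewrite (meanD mu1 (bounded_measurableB b2 bl) b1) (meanB mu1 b2 bl) (meanZ mu1 _ bg).
rewrite (mean_cst mu1 (m ^+ 2)) -/m.
have -> : \int[mu]_x (g x ^+ 2) = \int[mu]_x (g \* g) x by [].
by ring.
Qed.

Lemma l2norm_sqr (d : nat) (R : realType) (u : site d -> R) :
  (l2norm u ^+ 2 = \esum_(k in [set: site d]) (u k ^+ 2)%:E)%E.
Proof.
rewrite /l2norm; have -> : (\esum_(i in [set: site d]) (`|u i| ^+ 2)%:E)%E =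
    (\esum_(k in [set: site d]) (u k ^+ 2)%:E)%E.
  by apply: eq_esum => k _; rewrite real_normK ?num_real.
have : (0 <= \esum_(k in [set: site d]) (u k ^+ 2)%:E)%E.
  by apply: esum_ge0 => k _; rewrite lee_fin sqr_ge0.
case: (esum _ _) => [r| |]//; rewrite ?lee_fin => r0.
  by rewrite poweR_EFin -EFin_expe powR12_sqrt// sqr_sqrtr.
by rewrite poweRyr ?invr_eq0 ?pnatr_eq0// expe2 mulyy.
Qed.

Theorem theorem4p2 (R : realType) (d : nat) (p : site d -> site d -> R)
    (hp : nn_kernel p) (hmean : mean p != 0)
    (rho : R) (hrho : 0 <= rho <= 1)
    (nu : probability (conf d) R) (hnu : bernoulli_product rho nu)
    (P : R -> R.-pker (conf d) ~> (conf d)) (hP : exclusion_process p P)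
    (Q : R -> R.-pker (conf d * conf d) ~> (conf d * conf d)%type)
    (hQ : basic_coupling p Q)
    (f : conf d -> R) (hfb : bounded_fun f)
    (hfm : measurable_fun [set: conf d] f)
    (t : R) (ht : 0 <= t) :
  ('V_nu[semigroup P t f]
     <= l2norm (Psi nu Q t) ^+ 2 * l1norm (delta f) ^+ 2)%E.
Proof.
have [B bf] : exists B, bounded_measurable B f.
  have [M [_ hM]] := hfb; exists (M + 1); split=> // x.
  by apply: hM => //; rewrite ltrDl.
have bg := bounded_measurable_semigroup P t bf.
rewrite (variance_bounded nu bg) l2norm_sqr.
have -> : l1norm (delta f) = (\esum_(k in [set: site d]) (delta f k)%:E)%E.
  by apply: eq_esum => k _; rewrite ger0_norm// (delta_ge0 bf).
(* The finite set [A] depends on [e], but the bound on its gradient sum does not. *)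
apply/lee_addgt0Pr => e e0.
have [A hA] := efron_stein hnu bg e0.
apply: (@le_trans _ _ ((\sum_(i <- A)
  \int[nu]_x (site_gradient (semigroup P t f) i x ^+ 2))%:E + e%:E)%E).
  by rewrite -EFinD lee_fin.
by rewrite leeD2r// (sum_gradient_le hp hnu hP hQ ht bf).
Qed.
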